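(* Any finitely generated $\mathcal F$-representation $V$ of degree $k$ has a finite resolution (an exact sequence of $\mathcal F$-representations) $$0\longrightarrow \mathbb P_k\oplus\mathbb D_k\longrightarrow\cdots\longrightarrow\mathbb P_2\oplus\mathbb D_2\longrightarrow\mathbb P_1\oplus\mathbb D_1\longrightarrow\mathbb P_0\longrightarrow V\longrightarrow 0$$ where each $\mathbb P_i$ is a Schur projective of degree $k-i$ and each $\mathbb D_i$ is a direct sum of copies of the objects $D_{k-i+1}$ and $D_{k-i+2}$.
   Context: Conventions: maps act on the right, so for $f:X\to Y$, $g:Y\to Z$ the composite is written $fg:X\to Z$. $\mathcal F$ is the category with objects the finite sets $[k]=\{1,\dots,k\}$, $k\in\mathbb N=\{0,1,2,\dots\}$, and all functions as morphisms. $\mathcal V$ is the category of finite-dimensional $\mathbb Q$-vector spaces. An $\mathcal F$-representation is a functor $V:\mathcal F\to\mathcal V$; these form the category $\mathcal V^{\mathcal F}$ with natural transformations as morphisms; kernels, cokernels and exactness are objectwise. $\mathcal S_k$ is the symmetric group on $[k]$. $\mathbb Q\mathcal F([p],[q])$ denotes the free $\mathbb Q$-vector space on functions $[p]\to[q]$, with bilinear composition. Schur projectives: let $\mathcal S$ be the groupoid of bijections in $\mathcal F$ (the disjoint union of the $\mathcal S_j$), and let $\mathcal V^{\mathcal S}$ be the category of functors $\mathcal S\to\mathcal V$. For $W\in\mathcal V^{\mathcal S}$ of finite support let $\mathbb SW\in\mathcal V^{\mathcal F}$ be its image under the left adjoint of the restriction functor $\mathcal V^{\mathcal F}\to\mathcal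 V^{\mathcal S}$; explicitly $(\mathbb SW)(X)=\bigoplus_j W[j]\otimes_{\mathbb Q\mathcal S_j}\mathbb Q\mathcal F([j],X)$, where $\mathcal S_j$ acts on $\mathbb Q\mathcal F([j],X)$ by precomposition. A Schur projective of degree $k$ is a functor of the form $\mathbb SW$ where $W$ is supported on sets of cardinality at most $k$. An $\mathcal F$-representation is finitely generated if it is a quotient of a finite direct sum of functors $\mathbb Q\mathcal F([j],-)$. A finitely generated $V$ has degree $k$ if it is a quotient of a Schur projective of degree $k$; equivalently, if it has a generating set contained in $V[0],V[1],\dots,V[k]$. (So ''degree $k$'' means ''generated in degrees at most $k$''.) The representations $D_k$: let $\varepsilon_k=\frac1{k!}\sum_{\sigma\in\mathcal S_k}\operatorname{sign}(\sigma)\,\sigma\in\mathbb Q\mathcal F([k],[k])$, let $\iota_k:[k]\to[k+1]$ be the natural inclusion, and let $\partial_k=\varepsilon_k\iota_k\varepsilon_{k+1}\in\mathbb Q\mathcal F([k],[k+1])$. Let $\Lambda^k\subseteq\mathbb Q\mathcal F([k],-)$ be the image of the endomorphism $h\mapsto\varepsilon_k h$, let $d_k:\Lambda^{k+1}\to\Lambda^k$ be the map $h\mapsto\partial_k h$, and define $D_k=\operatorname{coker}(d_k)$ for $k\ge 0$.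
   Formalization: The formal theorem assumes k ≥ 1; for k = 0 the sequence would read 0 → P_0 → V → 0, which fails for V = D_0 (Q on the empty set, zero elsewhere): it has degree 0 but is not a Schur projective of degree 0. *)

(* Defs.v *)
From HB Require Import structures.
From mathcomp Require Import all_boot all_order all_algebra all_fingroup.

Set Implicit Arguments.
Unset Strict Implicit.
Unset Printing Implicit Defensive.

Import GRing.Theory.
Local Open Scope ring_scope.

Definition fmor (m n : nat) := {ffun 'I_m -> 'I_n}.

Definition fid (n : nat) : fmor n n := [ffun i => i].

(* The composite "fg": first f, then g. *)
Definition fcomp (p q r : nat) (f : fmor p q) (g : fmor q r) : fmor p r :=
  [ffun i => g (f i)].

Lemma fcompA p q r s (f : fmor p q) (g : fmor q r) (h : fmor r s) :
  fcomp f (fcomp g h) = fcomp (fcomp f g) h.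
Proof. by apply/ffunP=> i; rewrite !ffunE. Qed.

Lemma fcomp1f p q (f : fmor p q) : fcomp (fid p) f = f.
Proof. by apply/ffunP=> i; rewrite !ffunE. Qed.

Lemma fcompf1 p q (f : fmor p q) : fcomp f (fid q) = f.
Proof. by apply/ffunP=> i; rewrite !ffunE. Qed.

(* MathComp permutations also act on the right, (s * t) x = t (s x), so this
   sends s * t to fcomp (fperm s) (fperm t). *)
Definition fperm (n : nat) (s : 'S_n) : fmor n n := [ffun i => s i].

Lemma fpermM n (s t : 'S_n) : fperm (s * t)%g = fcomp (fperm s) (fperm t).
Proof. by apply/ffunP=> i; rewrite !ffunE permM. Qed.

Lemma fperm1 n : fperm (1%g : 'S_n) = fid n.
Proof. by apply/ffunP=> i; rewrite !ffunE perm1. Qed.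

Record frep := FRep {
  fob :> nat -> vectType rat;
  rmap : forall m n, fmor m n -> 'Hom(fob m, fob n);
  rmap_id : forall n (v : fob n), rmap (fid n) v = v;
  rmap_comp : forall p q r (f : fmor p q) (g : fmor q r) (v : fob p),
    rmap (fcomp f g) v = rmap g (rmap f v) }.

Arguments rmap V {m n} f : rename.

Record fhom (V W : frep) := FHom {
  fhom_at :> forall n, 'Hom(V n, W n);
  fhom_nat : forall m n (f : fmor m n) (v : V m),
    fhom_at n (rmap V f v) = rmap W f (fhom_at m v) }.

Definition fmono (V W : frep) (u : fhom V W) : Prop :=
  forall n, lker (u n) = 0%VS.

Definition fepi (V W : frep) (u : fhom V W) : Prop :=
  forall n, limg (u n) = fullv.

Definition fexact (U V W : frep) (u : fhom U V) (v : fhom V W) : Prop :=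
  forall n, limg (u n) = lker (v n).

Definition fiso (V W : frep) : Prop :=
  exists u : fhom V W, fmono u /\ fepi u.

Lemma linfunP (aT rT : vectType rat) (f : aT -> rT) (lf : linear f) (v : aT) :
  linfun f v = f v.
Proof.
pose F : {linear aT -> rT} :=
  HB.pack f (GRing.isLinear.Build rat aT rT *:%R f lf).
exact: (lfunE F v).
Qed.

Section Zero.
Let zob (n : nat) : vectType rat := 'rV[rat]_0.
Let zact m n (f : fmor m n) : 'Hom(zob m, zob n) := 0.
Fact fzero_id n (v : zob n) : zact (fid n) v = v.
Proof. by rewrite [LHS]thinmx0 [RHS]thinmx0. Qed.
Fact fzero_comp p q r (f : fmor p q) (g : fmor q r) (v : zob p) :
  zact (fcomp f g) v = zact g (zact f v).
Proof. by rewrite [LHS]thinmx0 [RHS]thinmx0. Qed.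
Definition fzero : frep := FRep fzero_id fzero_comp.
End Zero.

Section DirectSum.
Variables V W : frep.
Let sob (n : nat) : vectType rat := (V n * W n)%type.
Let sfun m n (f : fmor m n) (x : sob m) : sob n :=
  (rmap V f x.1, rmap W f x.2).
Let sact m n (f : fmor m n) : 'Hom(sob m, sob n) := linfun (sfun f).
Fact fsum_actE m n (f : fmor m n) (x : sob m) : sact f x = sfun f x.
Proof. by apply: linfunP => a y z; congr pair; rewrite /= linearP. Qed.
Fact fsum_id n (v : sob n) : sact (fid n) v = v.
Proof. by rewrite fsum_actE /sfun !rmap_id; case: v. Qed.
Fact fsum_comp p q r (f : fmor p q) (g : fmor q r) (v : sob p) :
  sact (fcomp f g) v = sact g (sact f v).
Proof. by rewrite !fsum_actE /sfun !rmap_comp. Qed.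
Definition fsum : frep := FRep fsum_id fsum_comp.
End DirectSum.

Definition fsums (Vs : seq frep) : frep := foldr fsum fzero Vs.

Section QuotientSpace.
Variables (vT : vectType rat) (U : {vspace vT}).

(* The quotient vT / U is realised on the complement of U; qproj is the
   projection along U. *)
Definition qspace : vectType rat := subvs_of (U^C)%VS.

Definition qproj : 'Hom(vT, qspace) :=
  (linfun (vsproj (U^C)%VS) \o daddv_pi (U^C)%VS U)%VF.

Definition qrepr : 'Hom(qspace, vT) := linfun (@vsval _ _ (U^C)%VS).

Lemma qproj_qrepr x : qproj (qrepr x) = x.
Proof.
rewrite /qproj comp_lfunE !lfunE /= daddv_pi_id ?subvsP //; first exact: vsvalK.
by rewrite capvC capv_compl.
Qed.

Lemma qrepr_qproj v : qrepr (qproj v) - v \in U.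
Proof.
have ev : daddv_pi (U^C)%VS U v + daddv_pi U (U^C)%VS v = v.
  apply: daddv_pi_add; first by rewrite capvC capv_compl.
  by rewrite addvC addv_complf memvf.
rewrite /qproj comp_lfunE !lfunE /= vsprojK ?memv_pi //.
by rewrite -{2}ev opprD addrA subrr add0r rpredN memv_pi.
Qed.

Lemma qproj_eq0 v : (qproj v == 0) = (v \in U).
Proof.
apply/eqP/idP => [e | Uv].
  by have := qrepr_qproj v; rewrite e linear0 sub0r rpredN.
have := rpredD (qrepr_qproj v) Uv; rewrite subrK => Uq.
suff q0 : qrepr (qproj v) = 0 by rewrite -[LHS]qproj_qrepr q0 linear0.
by apply/eqP; rewrite -memv0 -(capv_compl U) memv_cap Uq lfunE subvsP.
Qed.

End QuotientSpace.

Section Quotient.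
Variables (V : frep) (U : forall n, {vspace V n}).
Hypothesis Ust : forall m n (f : fmor m n) v, v \in U m -> rmap V f v \in U n.
Let qob n : vectType rat := qspace (U n).
Let qact m n (f : fmor m n) : 'Hom(qob m, qob n) :=
  (qproj (U n) \o rmap V f \o qrepr (U m))%VF.
Fact fquot_actE m n (f : fmor m n) v :
  qact f (qproj (U m) v) = qproj (U n) (rmap V f v).
Proof.
rewrite /qact 2!comp_lfunE; apply/eqP.
rewrite -subr_eq0 -linearB qproj_eq0 -linearB.
exact/Ust/qrepr_qproj.
Qed.
Fact fquot_id n (v : qob n) : qact (fid n) v = v.
Proof. by rewrite -[v]qproj_qrepr fquot_actE rmap_id. Qed.
Fact fquot_comp p q r (f : fmor p q) (g : fmor q r) (v : qob p) :
  qact (fcomp f g) v = qact g (qact f v).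
Proof. by rewrite -[v]qproj_qrepr !fquot_actE rmap_comp. Qed.
Definition fquot : frep := FRep fquot_id fquot_comp.
End Quotient.

Section Cokernel.
Variables (V W : frep) (u : fhom V W).
Fact fcoker_stable m n (f : fmor m n) w :
  w \in limg (u m) -> rmap W f w \in limg (u n).
Proof. by case/memv_imgP=> v _ ->; rewrite -fhom_nat memv_img ?memvf. Qed.
Definition fcoker : frep := fquot fcoker_stable.
End Cokernel.

Section Image.
Variables (V W : frep) (u : fhom V W).
Let iob n : vectType rat := subvs_of (limg (u n)).
Let iact m n (f : fmor m n) : 'Hom(iob m, iob n) :=
  (linfun (vsproj (limg (u n))) \o rmap W f \o linfun vsval)%VF.
Fact fimage_actE m n (f : fmor m n) (x : iob m) :
  vsval (iact f x) = rmap W f (vsval x).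
Proof.
by rewrite !comp_lfunE !lfunE /= vsprojK // fcoker_stable ?subvsP.
Qed.
Fact fimage_id n (v : iob n) : iact (fid n) v = v.
Proof. by apply: val_inj; rewrite /= fimage_actE rmap_id. Qed.
Fact fimage_comp p q r (f : fmor p q) (g : fmor q r) (v : iob p) :
  iact (fcomp f g) v = iact g (iact f v).
Proof. by apply: val_inj; rewrite /= !fimage_actE rmap_comp. Qed.
Definition fimage : frep := FRep fimage_id fimage_comp.
End Image.

(* For a vector space U, the functor U (x) Q F([j], -): the function F stands
   for the sum over h of F h (x) h, so QF j below is Q F([j], -). *)
Section Tensor.
Variables (U : vectType rat) (j : nat).
Let tob n : vectType rat := {ffun fmor j n -> U}.
Let tfun m n (f : fmor m n) (F : tob m) : tob n :=
  [ffun h => \sum_(g | fcomp g f == h) F g].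
Let tact m n (f : fmor m n) : 'Hom(tob m, tob n) := linfun (tfun f).
Fact ftens_actE m n (f : fmor m n) (F : tob m) (h : fmor j n) :
  tact f F h = \sum_(g | fcomp g f == h) F g.
Proof.
rewrite [tact _ _]linfunP ?ffunE // => a x y; apply/ffunP=> k.
rewrite !ffunE scaler_sumr -big_split; apply: eq_bigr => i _.
by rewrite !ffunE.
Qed.
Fact ftens_id n (F : tob n) : tact (fid n) F = F.
Proof.
apply/ffunP=> h; rewrite ftens_actE (big_pred1 h) // => g.
by rewrite fcompf1.
Qed.
Fact ftens_comp p q r (f : fmor p q) (g : fmor q r) (F : tob p) :
  tact (fcomp f g) F = tact g (tact f F).
Proof.
apply/ffunP=> h; rewrite !ftens_actE.
under [RHS]eq_bigr do rewrite ftens_actE.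
rewrite [LHS](partition_big (fun x => fcomp x f) (fun y => fcomp y g == h)) /=.
  apply: eq_bigr => y /eqP <-; apply: eq_bigl => x.
  by rewrite fcompA; case: (fcomp x f =P y) => [->|]; rewrite ?eqxx ?andbF.
by move=> x; rewrite fcompA.
Qed.
Definition ftens : frep := FRep ftens_id ftens_comp.
End Tensor.

Definition QF (j : nat) : frep := ftens rat^o j.

Definition qf_of (p q : nat) (f : fmor p q) : QF p q :=
  [ffun h => (h == f)%:R].

(* The bilinear extension of fcomp. *)
Definition qcomp (p q r : nat) (a : QF p q) (b : QF q r) : QF p r :=
  [ffun h => \sum_(x : fmor p q * fmor q r | fcomp x.1 x.2 == h)
               (a x.1 * b x.2 : rat)].

Lemma qcompE p q r (a : QF p q) (b : QF q r) h :
  qcomp a b h = \sum_f \sum_g a f * b g *+ (fcomp f g == h) :> rat.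
Proof. by rewrite ffunE big_mkcond pair_bigA; apply: eq_bigr => -[f g] _ /=;
  case: eqP. Qed.

Lemma qcompA p q r s (a : QF p q) (b : QF q r) (c : QF r s) :
  qcomp a (qcomp b c) = qcomp (qcomp a b) c.
Proof.
apply/ffunP=> h; rewrite !qcompE.
transitivity (\sum_f \sum_g \sum_k
    (a f * b g * c k *+ (fcomp f (fcomp g k) == h) : rat)).
  apply: eq_bigr => f _.
  under eq_bigr => g _ do rewrite qcompE mulr_sumr -sumrMnl.
  rewrite exchange_big; apply: eq_bigr => g _ /=.
  under eq_bigr => x _ do rewrite mulr_sumr -sumrMnl.
  rewrite exchange_big; apply: eq_bigr => k _ /=.
  rewrite (bigD1 (fcomp g k)) //= eqxx mulr1n mulrA big1 ?addr0 // => x.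
  by rewrite eq_sym => /negPf->; rewrite mulr0n mulr0 mul0rn.
rewrite [RHS]exchange_big /=.
under [LHS]eq_bigr => f _ do rewrite exchange_big.
rewrite [LHS]exchange_big; apply: eq_bigr => k _ /=.
under [RHS]eq_bigr => x _ do rewrite qcompE mulr_suml -sumrMnl.
rewrite [RHS]exchange_big; apply: eq_bigr => f _ /=.
under [RHS]eq_bigr => x _ do rewrite mulr_suml -sumrMnl.
rewrite [RHS]exchange_big; apply: eq_bigr => g _ /=.
rewrite [RHS](bigD1 (fcomp f g)) //= eqxx mulr1n fcompA big1 ?addr0 // => x.
by rewrite eq_sym => /negPf->; rewrite mulr0n mul0r mul0rn.
Qed.

Lemma qcomp_qf_of p q r (a : QF p q) (f : fmor q r) :
  qcomp a (qf_of f) = rmap (QF p) f a.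
Proof.
apply/ffunP=> h; rewrite qcompE ftens_actE [RHS]big_mkcond.
apply: eq_bigr => g _; rewrite (bigD1 f) //= ffunE eqxx mulr1 big1 ?addr0.
  by case: eqP.
by move=> k /negPf kf; rewrite ffunE kf mulr0 mul0rn.
Qed.

Lemma qcomp_is_linear p q r (a : QF p q) : linear (@qcomp p q r a).
Proof.
move=> c x y; apply/ffunP=> h; rewrite !ffunE scaler_sumr -big_split.
by apply: eq_bigr => i _; rewrite !ffunE /= mulrDr; congr +%R;
  rewrite /GRing.scale /= mulrCA.
Qed.

Section LeftMultiplication.
Variables (p q : nat) (a : QF p q).
Let lm n : 'Hom(QF q n, QF p n) := linfun (qcomp a).
Fact lmulE n (h : QF q n) : lm n h = qcomp a h.
Proof. by rewrite linfunP //; apply: qcomp_is_linear. Qed.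
Fact lmul_nat m n (f : fmor m n) (h : QF q m) :
  lm n (rmap (QF q) f h) = rmap (QF p) f (lm m h).
Proof. by rewrite !lmulE -!qcomp_qf_of qcompA. Qed.
(* The map h |-> a h, from Q F([q], -) to Q F([p], -). *)
Definition lmul : fhom (QF q) (QF p) := FHom lmul_nat.
End LeftMultiplication.

Definition eps (k : nat) : QF k k :=
  (k`!%:R^-1 : rat) *: \sum_(s : 'S_k) (-1 : rat) ^+ s *: qf_of (fperm s).

Definition incl (k : nat) : fmor k k.+1 := [ffun i => widen_ord (leqnSn k) i].

Definition bdry (k : nat) : QF k k.+1 :=
  qcomp (qcomp (eps k) (qf_of (incl k))) (eps k.+1).

Definition Lam (k : nat) : frep := fimage (lmul (eps k)).

Section Differential.
Variable k : nat.
Let dl n : 'Hom(Lam k.+1 n, Lam k n) :=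
  (linfun (vsproj (limg (lmul (eps k) n))) \o lmul (bdry k) n
     \o linfun vsval)%VF.
Fact dmapE n (x : Lam k.+1 n) : vsval (dl n x) = qcomp (bdry k) (vsval x).
Proof.
rewrite !comp_lfunE lfunE /= lfunE /= lmulE vsprojK //.
by rewrite /bdry -!qcompA -lmulE memv_img ?memvf.
Qed.
Fact dmap_nat m n (f : fmor m n) (x : Lam k.+1 m) :
  dl n (rmap (Lam k.+1) f x) = rmap (Lam k) f (dl m x).
Proof.
apply: val_inj; apply: etrans (dmapE _) _.
apply: etrans (congr1 _ (fimage_actE _ _)) _.
apply: esym; apply: etrans (fimage_actE _ _) _.
by rewrite dmapE -!qcomp_qf_of qcompA.
Qed.
Definition dmap : fhom (Lam k.+1) (Lam k) := FHom dmap_nat.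
End Differential.

Definition Drep (k : nat) : frep := fcoker (dmap k).

(* A functor from the groupoid of bijections to vector spaces: for each j, a
   right module over the symmetric group. *)
Record srep := SRep {
  sob :> nat -> vectType rat;
  sact : forall j, 'S_j -> 'End(sob j);
  sact_id : forall j (w : sob j), sact 1%g w = w;
  sact_comp : forall j (s t : 'S_j) (w : sob j),
    sact (s * t)%g w = sact t (sact s w) }.

Arguments sact W {j} s : rename.

Section Schur.
Variables (W : srep) (j : nat).

(* The endomorphism w (x) h |-> w s (x) h - w (x) s h. *)
Let relfun (s : 'S_j) n (F : ftens (W j) j n) : ftens (W j) j n :=
  [ffun h => sact W s (F h) - F (fcomp (fperm s^-1%g) h)].
Definition schur_rel (s : 'S_j) n : 'End(ftens (W j) j n) :=
  linfun (@relfun s n).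

Fact schur_relE s n (F : ftens (W j) j n) h :
  schur_rel s n F h = sact W s (F h) - F (fcomp (fperm s^-1%g) h).
Proof.
rewrite [schur_rel _ _ _]linfunP ?ffunE // => a x y; apply/ffunP=> k.
by rewrite !ffunE linearP scalerBr opprD addrACA.
Qed.

Fact schur_rel_nat s m n (f : fmor m n) (F : ftens (W j) j m) :
  schur_rel s n (rmap (ftens (W j) j) f F) =
  rmap (ftens (W j) j) f (schur_rel s m F).
Proof.
apply/ffunP=> h; rewrite schur_relE !ftens_actE.
under [RHS]eq_bigr => g _ do rewrite schur_relE.
rewrite sumrB linear_sum; congr (_ - _).
rewrite (reindex (fcomp (fperm s^-1%g))) /=.
  apply: eq_bigl => g; rewrite -fcompA; apply/eqP/eqP => [|-> //].
  move/(congr1 (fcomp (fperm s))).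
  by rewrite !fcompA -fpermM mulgV fperm1 !fcomp1f.
exists (fcomp (fperm s)) => g _.
  by rewrite fcompA -fpermM mulgV fperm1 fcomp1f.
by rewrite fcompA -fpermM mulVg fperm1 fcomp1f.
Qed.

Definition schur_relations n : {vspace ftens (W j) j n} :=
  (\sum_(s : 'S_j) limg (schur_rel s n))%VS.

Fact schur_relations_stable m n (f : fmor m n) F :
  F \in schur_relations m -> rmap (ftens (W j) j) f F \in schur_relations n.
Proof.
case/memv_sumP=> G GP ->; rewrite linear_sum; apply: memv_sumr => s _.
have /memv_imgP[v _ ->] := GP s isT.
by move: (schur_rel_nat s f v) => /= <-; rewrite memv_img ?memvf.
Qed.

(* W[j] (x)_(Q S_j) Q F([j], -) *)
Definition schur_at : frep := fquot schur_relations_stable.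

End Schur.

(* The sum over j < N, which is all of S W when W j = 0 for every j >= N. *)
Definition schur (N : nat) (W : srep) : frep :=
  fsums [seq schur_at W j | j <- iota 0 N].

Definition supported (k : nat) (W : srep) : Prop :=
  forall j, (k < j)%N -> \dim {:W j} = 0%N.

Definition schur_projective (k : nat) (P : frep) : Prop :=
  exists W : srep, supported k W /\ fiso P (schur k.+1 W).

Definition finitely_generated (V : frep) : Prop :=
  exists (js : seq nat) (u : fhom (fsums [seq QF j | j <- js]) V), fepi u.

Definition has_degree (k : nat) (V : frep) : Prop :=
  exists (P : frep) (u : fhom P V), schur_projective k P /\ fepi u.

Definition sum_of_D (a b : nat) (V : frep) : Prop :=
  exists m n : nat, fiso V (fsums (nseq m (Drep a) ++ nseq n (Drep b))).

(* P_0 in degree 0 and P_i (+) D_i in degree i > 0. *)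
Definition res_term (P D : nat -> frep) (i : nat) : frep :=
  if i is 0 then P 0%N else fsum (P i) (D i).

(* Main.v *)
Require Import Defs.
From mathcomp Require Import all_boot all_order all_algebra all_fingroup.

(** Call a functor X pure of type m > 0 when it vanishes below degree m, is
  alternating in degree m, and is both generated and detected by X[m].  The
  object D_m is pure with a one-dimensional value at [m], and a pure object is
  determined by the dimension of its value at [m] ([pure_iso]).  Hence the pure
  objects of type m are the sums of copies of D_m ([pure_classification]), and
  every subobject of a pure object is a direct summand ([pure_complement]).

  Purity is expressed by one operator.  Fix the base point ord0 of [n+1]; for a
  set S of m points containing it, let r_S retract [n+1] onto S by sending all
  other points to ord0.  The condition is that the sum of the r_S acts as the
  identity ([koszul]).  As each r_S factors through [m], this yields generation
  and detection at once, and it passes to subobjects, quotients and sums.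

  Let V be generated in degrees at most k.  In each degree j choose an
  S_j-stable complement of what lower degrees generate; this gives a Schur
  projective [fcover V k.+1] with an epimorphism to V.  The crucial fact is that
  its kernel K is a direct sum M + A + B, with M generated in degrees below k, A
  pure of type k and B pure of type k+1 ([kernel_structure]).  To see this, let
  K1 consist of the elements of K whose degree-k component is supported on
  noninjective functions.
  - The choice of generators is minimal, so the degree-k component F of an
    element of K sums to zero over the sections of every function from [n] to
    [k].  A count of sections turns this into purity of K / K1 of type k+1
    ([sections_alternate], [sections_koszul]).
  - The quotient K / K1 lifts to a subobject B ([pure_split]): an alternating
    vector generates a pure subfunctor as soon as there are no alternating
    vectors one degree higher, and a functor generated in degrees at most k has
    none in degree k+2 ([no_signv]).
  - Noninjective functions on [k] factor through smaller sets, so K1 is the sum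
    of a part generated below degree k and of the kernel for the generators of
    degree below k.  By induction the latter adds only a pure part of type k, in
    which A is a complement of what has been reached already.

  Repeating the construction with M in place of V produces the resolution.  It
  stops in degree 0: there M is a subfunctor of a Schur projective, so every map
  out of M[0] is injective, and M is a Schur projective itself
  ([fcover1_mono]). *)

Set Implicit Arguments.
Unset Strict Implicit.
Unset Printing Implicit Defensive.

Import GRing.Theory Num.Theory.
Local Open Scope ring_scope.

(** * Subfunctors *)

Definition fstable (X : frep) (U : forall n, {vspace X n}) : Prop :=
  forall m n (f : fmor m n) x, x \in U m -> rmap X f x \in U n.

Section SubRepresentation.
Variables (X : frep) (U : forall n, {vspace X n}) (stU : fstable U).
Let sob n : vectType rat := subvs_of (U n).
Let sact m n (f : fmor m n) : 'Hom(sob m, sob n) :=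
  (linfun (vsproj (U n)) \o rmap X f \o linfun vsval)%VF.
Fact fsubrep_actE m n (f : fmor m n) (x : sob m) :
  vsval (sact f x) = rmap X f (vsval x).
Proof. by rewrite !comp_lfunE !lfunE /= vsprojK // stU ?subvsP. Qed.
Fact fsubrep_id n (v : sob n) : sact (fid n) v = v.
Proof. by apply: val_inj; rewrite /= fsubrep_actE rmap_id. Qed.
Fact fsubrep_comp p q r (f : fmor p q) (g : fmor q r) (v : sob p) :
  sact (fcomp f g) v = sact g (sact f v).
Proof. by apply: val_inj; rewrite /= !fsubrep_actE rmap_comp. Qed.
Definition fsubrep : frep := FRep fsubrep_id fsubrep_comp.

Let inc n : 'Hom(fsubrep n, X n) := linfun vsval.
Fact fsubincE n (x : fsubrep n) : inc n x = vsval x.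
Proof. by rewrite lfunE. Qed.
Fact fsubinc_nat m n (f : fmor m n) (x : fsubrep m) :
  inc n (rmap fsubrep f x) = rmap X f (inc m x).
Proof. by rewrite !fsubincE fsubrep_actE. Qed.
Definition fsubinc : fhom fsubrep X := FHom fsubinc_nat.

Lemma fsubinc_mem n (x : fsubrep n) : fsubinc n x \in U n.
Proof. by rewrite fsubincE subvsP. Qed.

Lemma fsubinc_inj n : injective (fsubinc n).
Proof. by move=> x y; rewrite !fsubincE; apply: val_inj. Qed.

Lemma fsubinc_lift n x : x \in U n -> exists y : fsubrep n, fsubinc n y = x.
Proof. by move=> Ux; exists (vsproj (U n) x); rewrite fsubincE vsprojK. Qed.

End SubRepresentation.

Lemma homD (aT rT : vectType rat) (u : 'Hom(aT, rT)) x y : u (x + y) = u x + u y.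
Proof. exact: linearD. Qed.

Lemma homB (aT rT : vectType rat) (u : 'Hom(aT, rT)) x y : u (x - y) = u x - u y.
Proof. exact: linearB. Qed.

Lemma lker0I (aT rT : vectType rat) (u : 'Hom(aT, rT)) :
  (forall x, u x = 0 -> x = 0) -> lker u = 0%VS.
Proof.
move=> inj; apply/eqP; rewrite -subv0; apply/subvP => x.
by rewrite memv_ker memv0 => /eqP/inj->.
Qed.

Lemma lker0_eq0 (aT rT : vectType rat) (u : 'Hom(aT, rT)) x :
  lker u = 0%VS -> u x = 0 -> x = 0.
Proof. by move=> k0 ux; apply/eqP; rewrite -memv0 -k0 memv_ker ux. Qed.

Lemma limg_fullP (aT rT : vectType rat) (u : 'Hom(aT, rT)) :
  (forall y, exists x, u x = y) <-> limg u = fullv.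
Proof.
split=> [sur | im y].
  apply/eqP; rewrite eqEsubv subvf; apply/subvP => y _.
  by have [x <-] := sur y; rewrite memv_img ?memvf.
have /memv_imgP[x _ ->] : y \in limg u by rewrite im memvf.
by exists x.
Qed.

Lemma lker_stable (X Y : frep) (u : fhom X Y) : fstable (fun n => lker (u n)).
Proof.
by move=> m n f x; rewrite !memv_ker fhom_nat => /eqP->; rewrite linear0.
Qed.

Lemma capv_stable (X : frep) (U T : forall n, {vspace X n}) :
  fstable U -> fstable T -> fstable (fun n => (U n :&: T n)%VS).
Proof.
by move=> sU sT m n f x; rewrite !memv_cap => /andP[/sU-> /sT->].
Qed.

Lemma preim_stable (X Y : frep) (u : fhom X Y) (T : forall n, {vspace Y n}) :
  fstable T -> fstable (fun n => (u n @^-1: T n)%VS).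
Proof. by move=> sT m n f x; rewrite -!memv_preim fhom_nat => /sT->. Qed.

Lemma img_stable (X Y : frep) (u : fhom X Y) (U : forall n, {vspace X n}) :
  fstable U -> fstable (fun n => (u n @: U n)%VS).
Proof.
move=> sU m n f _ /memv_imgP[x Ux ->].
by rewrite -fhom_nat memv_img ?sU.
Qed.

(** The subfunctor generated by the values of U in degrees below k. *)
Definition gsub (X : frep) (k : nat) (U : forall n, {vspace X n}) n :
    {vspace X n} :=
  (\sum_(j < k) \sum_(f : fmor j n) (rmap X f @: U j))%VS.

Section Generation.
Variable X : frep.
Implicit Types U T : forall n, {vspace X n}.

Lemma mem_gsub k U n j (f : fmor j n) x :
  (j < k)%N -> x \in U j -> rmap X f x \in gsub k U n.
Proof.
move=> jk Ux; rewrite /gsub.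
apply: (subvP (sumv_sup (Ordinal jk) isT (subvv _))).
by apply: (subvP (sumv_sup f isT (subvv _))); rewrite memv_img.
Qed.

Lemma gsub_sub k U n (T : {vspace X n}) :
  (forall j (f : fmor j n) x, (j < k)%N -> x \in U j -> rmap X f x \in T) ->
  (gsub k U n <= T)%VS.
Proof.
move=> sUT; apply/subv_sumP => j _; apply/subv_sumP => f _.
by apply/subvP => _ /memv_imgP[x Ux ->]; apply: sUT.
Qed.

Lemma gsub_stable k U : fstable (gsub k U).
Proof.
move=> m n f x Ux.
suff /subvP/(_ _ Ux) : (gsub k U m <= rmap X f @^-1: gsub k U n)%VS.
  by rewrite -memv_preim.
apply: gsub_sub => j g y jk Uy; rewrite -memv_preim -rmap_comp.
exact: mem_gsub.
Qed.

Lemma gsub_le k U n : fstable U -> (gsub k U n <= U n)%VS.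
Proof. by move=> stU; apply: gsub_sub => j f x _; apply: stU. Qed.

Lemma mem_gsub_id k U n x : (n < k)%N -> x \in U n -> x \in gsub k U n.
Proof. by move=> nk Ux; rewrite -[x]rmap_id mem_gsub. Qed.

Lemma gsub_mono k l U T n : (k <= l)%N ->
  (forall j, (j < k)%N -> (U j <= T j)%VS) -> (gsub k U n <= gsub l T n)%VS.
Proof.
move=> kl UT; apply: gsub_sub => j f x jk Ux.
by apply: mem_gsub; [apply: leq_trans kl | apply: (subvP (UT j jk))].
Qed.

Definition gen_sub k U : Prop := forall n, (U n <= gsub k U n)%VS.

End Generation.

(** The bound is strict, so that k = 0 leaves only the zero functor; a functor of
  degree k satisfies [gen_lt k.+1]. *)
Definition gen_lt (k : nat) (X : frep) : Prop :=
  @gen_sub X k (fun n => fullv).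

Lemma gen_lt_subrep (X : frep) (U : forall n, {vspace X n}) (stU : fstable U) k :
  gen_sub k U -> gen_lt k (fsubrep stU).
Proof.
move=> gU n; apply/subvP => x _.
have Ux := subvP (gU n) _ (fsubinc_mem x).
suff /subvP/(_ _ Ux) : (gsub k U n <=
    fsubinc stU n @: gsub k (fun n => (fullv : {vspace fsubrep stU n})) n)%VS.
  by case/memv_imgP=> y yG /fsubinc_inj->.
apply: gsub_sub => j f y jk /(fsubinc_lift stU)[z <-].
by rewrite -fhom_nat memv_img // mem_gsub ?memvf.
Qed.

Lemma gsub_hom (X Y : frep) (u : fhom X Y) k
    (U : forall n, {vspace X n}) (T : forall n, {vspace Y n}) n x :
    (forall j y, (j < k)%N -> y \in U j -> u j y \in T j) ->
  x \in gsub k U n -> u n x \in gsub k T n.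
Proof.
move=> UT Ux.
suff /subvP/(_ _ Ux) : (gsub k U n <= u n @^-1: gsub k T n)%VS.
  by rewrite -memv_preim.
apply: gsub_sub => j f y jk Uy.
by rewrite -memv_preim fhom_nat mem_gsub ?UT.
Qed.

Lemma gen_lt_epi (X Y : frep) (u : fhom X Y) k :
  (forall n y, exists x, u n x = y) -> gen_lt k X -> gen_lt k Y.
Proof.
move=> us gX n; apply/subvP => y _; have [x <-] := us n y.
by apply: gsub_hom (subvP (gX n) x (memvf x)) => *; rewrite memvf.
Qed.

Lemma gen_lt_mono (X : frep) k l : (k <= l)%N -> gen_lt k X -> gen_lt l X.
Proof. by move=> kl gX n; apply: subv_trans (gX n) (gsub_mono _ kl _). Qed.

(** * Alternating vectors *)

Definition signv (X : frep) n (x : X n) : Prop :=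
  forall a b : 'I_n, a != b -> rmap X (fperm (tperm a b)) x = - x.

(** n! times the projection onto the alternating vectors. *)
Definition asym (X : frep) n : 'End(X n) :=
  \sum_(s : 'S_n) (-1) ^+ s *: rmap X (fperm s).

Section Alternating.
Variable X : frep.

Lemma asymE n (x : X n) :
  asym X n x = \sum_(s : 'S_n) (-1) ^+ s *: rmap X (fperm s) x.
Proof.
by rewrite sum_lfunE; apply: eq_bigr => s _; rewrite scale_lfunE.
Qed.

(** Computing modulo a stable subspace L covers both alternating vectors (L = 0)
  and vectors that are alternating in a quotient. *)
Lemma perm_mod_sign n (L : {vspace X n}) x :
    (forall s l, l \in L -> rmap X (fperm s) l \in L) ->
    (forall a b : 'I_n, a != b -> rmap X (fperm (tperm a b)) x + x \in L) ->
  forall s : 'S_n, rmap X (fperm s) x - (-1) ^+ s *: x \in L.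
Proof.
move=> stL tL s; have [ts -> dts] := prod_tpermP s.
elim: ts dts => [_|[a b] ts IH /= /andP[/= ab dts]].
  by rewrite big_nil fperm1 rmap_id odd_perm1 scale1r subrr mem0v.
rewrite big_cons /= fpermM rmap_comp odd_mul_tperm.
set s' := (\prod_(t <- ts) _)%g in IH *; rewrite ab /=.
have := rpredB (stL s' _ (tL a b ab)) (IH dts); rewrite linearD /=.
rewrite signrN scaleNr.
by congr (_ \in L); rewrite opprK opprB -addrA (addrC (rmap X _ x)) subrK.
Qed.

Lemma signv_perm n (x : X n) (s : 'S_n) :
  signv x -> rmap X (fperm s) x = (-1) ^+ s *: x.
Proof.
move=> sx; apply/eqP; rewrite -subr_eq0 -memv0; apply: perm_mod_sign.
  by move=> t l; rewrite memv0 => /eqP->; rewrite linear0 mem0v.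
by move=> a b ab; rewrite sx // addNr mem0v.
Qed.

(** The transposition of two points with the same image fixes f and negates x. *)
Lemma signv_noninj m n (f : fmor m n) (x : X m) :
  ~~ injectiveb f -> signv x -> rmap X f x = 0.
Proof.
case/injectivePn=> a [b ab fab] sx.
have: rmap X f x = - rmap X f x.
  rewrite -linearN /= -(sx _ _ ab) -rmap_comp; congr (rmap X _ x).
  apply/ffunP=> i; rewrite !ffunE.
  by case: tpermP => [->|->|].
move/eqP; rewrite -subr_eq0 opprK -mulr2n -scaler_nat scaler_eq0.
by rewrite pnatr_eq0 => /eqP.
Qed.

Lemma asym_perm n (x : X n) (t : 'S_n) :
  rmap X (fperm t) (asym X n x) = (-1) ^+ t *: asym X n x.
Proof.
rewrite asymE linear_sum (reindex_inj (mulIg t^-1%g)) scaler_sumr /=.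
apply: eq_bigr => s _; rewrite linearZ /= -rmap_comp -fpermM mulgKV.
by rewrite odd_permM odd_permV signr_addb scalerA mulrC.
Qed.

Lemma signv_asym n (x : X n) : signv (asym X n x).
Proof.
by move=> a b ab; rewrite asym_perm odd_tperm ab expr1 scaleN1r.
Qed.

Lemma asym_signv n (x : X n) : signv x -> asym X n x = n`!%:R *: x.
Proof.
move=> sx; rewrite asymE.
under eq_bigr => s _ do rewrite (signv_perm s sx) scalerA -expr2 sqrr_sign scale1r.
by rewrite sumr_const card_Sn scaler_nat.
Qed.

Lemma asym_fixed n (x : X n) (a b : 'I_n) :
  a != b -> rmap X (fperm (tperm a b)) x = x -> asym X n x = 0.
Proof.
move=> ab fx; have: asym X n x = - asym X n x.
  rewrite asymE -sumrN [LHS](reindex_inj (mulgI (tperm a b))) /=.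
  apply: eq_bigr => s _; rewrite fpermM rmap_comp fx odd_mul_tperm ab.
  by rewrite signr_addb expr1 mulN1r scaleNr.
move/eqP; rewrite -subr_eq0 opprK -mulr2n -scaler_nat scaler_eq0.
by rewrite pnatr_eq0 => /eqP.
Qed.

Lemma two_missing j n (f : fmor j n) : (j.+1 < n)%N ->
  exists a b : 'I_n, [/\ a != b, a \notin codom f & b \notin codom f].
Proof.
move=> jn; have : (1 < #|[predC codom f]|)%N.
  have := cardC (mem (codom f)); rewrite card_ord => nE.
  have fj : (#|codom f| <= j)%N by have := leq_image_card f predT; rewrite card_ord.
  rewrite -(leq_add2l #|codom f|) nE.
  by apply: leq_trans jn; rewrite addn2 !ltnS.
case/card_gt1P=> a [b []]; rewrite !inE => fa fb ab.
by exists a, b.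
Qed.

(** A function into [n] that misses two points is unchanged when these are
  transposed, so nothing that it produces survives antisymmetrisation. *)
Lemma no_signv k n (x : X n) :
  gen_lt k X -> (k < n)%N -> signv x -> x = 0.
Proof.
move=> gX kn sx; have: asym X n x = 0.
  apply/eqP; rewrite -memv_ker; apply: subvP x {sx} (memvf _).
  apply: subv_trans (gX n) (gsub_sub _) => j f x jk _.
  rewrite memv_ker; apply/eqP.
  have [a [b [ab fa fb]]] := two_missing f (leq_ltn_trans jk kn).
  apply: (asym_fixed ab); rewrite -rmap_comp; congr (rmap X _ x).
  apply/ffunP=> i; rewrite !ffunE tpermD //.
    by apply: contraNneq fa => ->; apply: codom_f.
  by apply: contraNneq fb => ->; apply: codom_f.
rewrite (asym_signv sx) => /eqP; rewrite scaler_eq0 pnatr_eq0.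
by rewrite -leqn0 leqNgt fact_gt0 => /eqP.
Qed.

End Alternating.

Lemma asym_nat (X Y : frep) (u : fhom X Y) n (x : X n) :
  u n (asym X n x) = asym Y n (u n x).
Proof.
rewrite !asymE linear_sum; apply: eq_bigr => s _.
by rewrite linearZ /= fhom_nat.
Qed.

Lemma signvZ (X : frep) n c (x : X n) : signv x -> signv (c *: x).
Proof. by move=> sx a b ab; rewrite linearZ /= sx // scalerN. Qed.

Lemma signv_nat (X Y : frep) (u : fhom X Y) n (x : X n) :
  signv x -> signv (u n x).
Proof. by move=> sx a b ab; rewrite -fhom_nat sx // linearN. Qed.

Lemma signv_inj (X Y : frep) (u : fhom X Y) n (x : X n) :
  injective (u n) -> signv (u n x) -> signv x.
Proof.
move=> ui sx a b ab; apply: ui; rewrite fhom_nat sx //.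
by rewrite linearN.
Qed.

(** * Pure subfunctors *)

Definition retr n (S : {set 'I_n.+1}) : fmor n.+1 n.+1 :=
  [ffun i => if i \in S then i else ord0].

Definition setinc n m (S : {set 'I_n.+1}) : fmor m.+1 n.+1 :=
  [ffun i : 'I_m.+1 => nth ord0 (enum S) i].

(** With [setinc], a factorisation of [retr S] through [m+1]; when S contains ord0
  and has m+1 elements, the indices stay in range. *)
Definition setproj n m (S : {set 'I_n.+1}) : fmor n.+1 m.+1 :=
  [ffun i => inord (index (if i \in S then i else ord0) (enum S))].

Lemma setproj_inc n m (S : {set 'I_n.+1}) :
  ord0 \in S -> #|S| = m.+1 -> fcomp (setproj m S) (setinc m S) = retr S.
Proof.
move=> S0 Sm; apply/ffunP=> i; rewrite !ffunE.
have Si : (if i \in S then i else ord0) \in enum S.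
  by rewrite mem_enum; case: ifP.
by rewrite inordK ?nth_index // -Sm cardE index_mem.
Qed.

Definition based_sets n m : {set {set 'I_n.+1}} :=
  [set S : {set 'I_n.+1} | (ord0 \in S) && (#|S| == m.+1)].

(** The list is empty when n or m is 0: this makes a pure object of type m > 0
  vanish at [0], and leaves 0 as the only pure object of type 0. *)
Definition koszul_pairs n m : seq (fmor n m * fmor m n) :=
  match n, m with
  | n'.+1, m'.+1 =>
      [seq (setproj m' A, setinc m' A) | A <- enum (based_sets n' m')]
  | _, _ => [::]
  end.

(** In D_m the exterior monomials e_S with ord0 in S span the value at [n+1], and
  [retr S] kills all of them except e_S, which it fixes; so the sum of the
  retractions is the identity there. *)
Definition koszul (X : frep) n m : 'End(X n) :=
  \sum_(p <- koszul_pairs n m) (rmap X p.2 \o rmap X p.1)%VF.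

Section KoszulOperator.
Variable X : frep.

Lemma koszulE n m (x : X n) :
  koszul X n m x = \sum_(p <- koszul_pairs n m) rmap X p.2 (rmap X p.1 x).
Proof.
rewrite /koszul; elim: (koszul_pairs n m) => [|p s IH]; first by rewrite !big_nil zero_lfunE.
by rewrite !big_cons add_lfunE IH comp_lfunE.
Qed.

Lemma koszul_retr n m (x : X n.+1) :
  koszul X n.+1 m.+1 x = \sum_(S in based_sets n m) rmap X (retr S) x.
Proof.
rewrite koszulE big_map big_enum; apply: eq_bigr => S.
by rewrite inE => /andP[S0 /eqP Sm] /=; rewrite -rmap_comp setproj_inc.
Qed.

Lemma koszul_deg0 n (x : X n) : koszul X n 0 x = 0.
Proof. by rewrite koszulE; case: n x => [|n] x; rewrite big_nil. Qed.

Lemma koszul_low n m (x : X n) : (n < m)%N -> koszul X n m x = 0.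
Proof.
case: n x => [|n] x; first by rewrite koszulE big_nil.
case: m => // m nm; rewrite koszul_retr big1 // => S.
rewrite inE => /andP[_ /eqP Sm]; have := max_card (mem S).
by rewrite Sm card_ord leqNgt nm.
Qed.

Lemma koszul_mem n m (L : {vspace X n}) x :
    (forall (g : fmor n m) (f : fmor m n), rmap X f (rmap X g x) \in L) ->
  koszul X n m x \in L.
Proof. by move=> Lx; rewrite koszulE; apply: rpred_sum => p _; apply: Lx. Qed.

End KoszulOperator.

Lemma koszul_nat (X Y : frep) (u : fhom X Y) n m x :
  u n (koszul X n m x) = koszul Y n m (u n x).
Proof.
rewrite !koszulE linear_sum; apply: eq_bigr => p _ /=.
by rewrite !fhom_nat.
Qed.

(** Purity of the subquotient U / L, stated without forming the quotient. *)
Definition pure_mod (X : frep) m (L U : forall n, {vspace X n}) : Prop :=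
  (forall n x, x \in U n -> x - koszul X n m x \in L n) /\
  (forall a b : 'I_m, a != b -> forall x, x \in U m ->
     rmap X (fperm (tperm a b)) x + x \in L m).

Definition pure_sub (X : frep) m (U : forall n, {vspace X n}) : Prop :=
  (forall n x, x \in U n -> koszul X n m x = x) /\
  (forall x, x \in U m -> signv x).

Definition pure (m : nat) (X : frep) : Prop :=
  @pure_sub X m (fun n => fullv).

Lemma pure_subrep (X : frep) (U : forall n, {vspace X n}) (stU : fstable U) m :
  pure_sub m U -> pure m (fsubrep stU).
Proof.
case=> kU sU; split=> [n x _ | x _ a b ab]; apply: (@fsubinc_inj _ _ stU).
  by rewrite koszul_nat kU // fsubinc_mem.
by rewrite fhom_nat linearN /= sU // fsubinc_mem.
Qed.

(** The scalar depends on f alone, so that every linear map between alternating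
  values at [m] commutes with the endomorphisms of [m]. *)
Lemma endo_signv m (f : fmor m m) :
  exists c : rat, forall (X : frep) (x : X m), signv x -> rmap X f x = c *: x.
Proof.
case: (boolP (injectiveb f)) => [/injectiveP fi | fn].
  exists ((-1) ^+ perm fi) => X x sx; rewrite -(signv_perm (perm fi) sx).
  by congr (rmap X _ x); apply/ffunP=> i; rewrite ffunE permE.
by exists 0 => X x sx; rewrite scale0r (signv_noninj fn).
Qed.

Lemma lift_perm_max m (s : 'S_m.+1) : s ord_max = ord_max ->
  exists t : 'S_m, s = lift_perm ord_max ord_max t.
Proof.
move=> smax.
pose t k := odflt k (unlift ord_max (s (lift ord_max k))).
have tK k : lift ord_max (t k) = s (lift ord_max k).
  rewrite /t; have := neq_lift ord_max k.
  by rewrite -(can_eq (permK s)) smax => /unlift_some[? ? ->].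
have t_inj : injective t.
  by move=> i j /(congr1 (lift ord_max)); rewrite !tK => /perm_inj/lift_inj.
exists (perm t_inj); apply/permP=> k.
case: (unliftP ord_max k) => [j|] ->; last by rewrite lift_perm_id.
by rewrite lift_perm_lift permE tK.
Qed.

Lemma inclE m (i : 'I_m) : incl m i = lift ord_max i.
Proof. by rewrite ffunE; apply: val_inj; exact: esym (lift_max i). Qed.

(** When the image of f contains the base point, [retr S] kills f u unless S is
  the image of f, and then it fixes f u.  Otherwise extend f to [m+2] by sending
  the new point to the base point: the extension carries the vanishing
  antisymmetrisation of u to a relation that expresses f u through functions
  whose image contains the base point. *)
Section SignGenerator.
Variables (X : frep) (m : nat) (u : X m.+1).
Hypotheses (su : signv u) (du : asym X m.+2 (rmap X (incl m.+1) u) = 0).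

Let koszul_noninj n (f : fmor m.+1 n.+1) :
  ~~ injectiveb f -> koszul X n.+1 m.+1 (rmap X f u) = rmap X f u.
Proof. by move=> fn; rewrite (signv_noninj fn su) linear0. Qed.

Let koszul_based n (f : fmor m.+1 n.+1) :
  ord0 \in codom f -> koszul X n.+1 m.+1 (rmap X f u) = rmap X f u.
Proof.
case/codomP=> i0 fi0.
case: (boolP (injectiveb f)) => [/injectiveP f_inj | /koszul_noninj//].
have Sf : [set f i | i in 'I_m.+1] \in based_sets n m.
  by rewrite inE card_imset // card_ord eqxx andbT fi0 imset_f.
rewrite koszul_retr (bigD1 _ Sf) big1 => [|S /andP[SB neS]].
  rewrite /= addr0 -rmap_comp; congr (rmap X _ u); apply/ffunP=> i.
  by rewrite !ffunE imset_f.
have {SB}: S \in based_sets n m by []; rewrite inE => /andP[S0 /eqP Sm].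
have [i fiS] : exists i, f i \notin S.
  apply/existsP; apply: contraR neS; rewrite negb_exists => /forallP fS.
  rewrite eq_sym eqEcard card_imset // card_ord Sm leqnn andbT.
  apply/subsetP => _ /imsetP[i _ ->].
  by have := fS i; rewrite negbK.
rewrite -rmap_comp; apply: signv_noninj su; apply/injectivePn.
exists i; exists i0; last by rewrite !ffunE (negPf fiS) -fi0 S0.
by apply: contraNneq fiS => ->; rewrite -fi0.
Qed.

Lemma koszul_sign_generator n (f : fmor m.+1 n) :
  koszul X n m.+1 (rmap X f u) = rmap X f u.
Proof.
case: n f => [|n] f; first by case: (f ord0).
pose h : fmor m.+2 n.+1 :=
  [ffun i => if unlift ord_max i is Some j then f j else ord0].
have h_lift j : h (lift ord_max j) = f j by rewrite ffunE liftK.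
have h_max : h ord_max = ord0 by rewrite ffunE unlift_none.
pose T := lker (koszul X n.+1 m.+1 - \1)%VF.
have inT x : (x \in T) = (koszul X n.+1 m.+1 x == x).
  by rewrite memv_ker add_lfunE opp_lfunE id_lfunE subr_eq0.
apply/eqP; rewrite -inT.
have := congr1 (rmap X h) du; rewrite linear0 asymE linear_sum /=.
rewrite (bigID (fun s : 'S_m.+2 => s ord_max == ord_max)) /=.
rewrite (eq_bigr (fun => rmap X f u)) => [|s /eqP smax]; last first.
  have [t st] := lift_perm_max smax.
  rewrite linearZ -!rmap_comp /= st odd_lift_perm addbb addFb.
  transitivity ((-1) ^+ t *: rmap X f (rmap X (fperm t) u)).
    rewrite -!rmap_comp; congr (_ *: rmap X _ u); apply/ffunP=> i.
    rewrite ffunE [X in h X]ffunE inclE [X in h X]ffunE lift_perm_lift h_lift.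
    by rewrite !ffunE.
  by rewrite (signv_perm t su) linearZ scalerA -expr2 sqrr_sign scale1r.
rewrite sumr_const => /eqP; rewrite addr_eq0 => /eqP e.
have N0 : #|[pred s : 'S_m.+2 | s ord_max == ord_max]|%:R != 0 :> rat.
  rewrite pnatr_eq0 -lt0n; apply/card_gt0P.
  by exists 1%g; rewrite inE perm1.
rewrite -[rmap X f u](scalerK N0) memvZ // scaler_nat e rpredN.
apply: rpred_sum => s smax; rewrite linearZ memvZ //= -!rmap_comp inT.
apply/eqP/koszul_based; apply/codomP.
have /unlift_some[j jE _] : ord_max != (s^-1)%g ord_max.
  by apply: contraNneq smax => mE; rewrite [X in s X]mE permKV.
exists j; rewrite !fcompA ffunE [X in h X]ffunE inclE [X in h X]ffunE -jE permKV.
by rewrite h_max.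
Qed.

End SignGenerator.

(** B is generated by antisymmetrised lifts of a complement of L in degree m.  The
  last hypothesis makes the antisymmetrisation of these lifts in degree m+1
  vanish, so [koszul_sign_generator] applies to them. *)
Lemma pure_split (X : frep) m (L U : forall n, {vspace X n}) :
    fstable L -> fstable U -> (forall n, (L n <= U n)%VS) ->
    pure_mod m L U -> (forall x, x \in U m.+1 -> signv x -> x = 0) ->
  exists B : forall n, {vspace X n},
    [/\ fstable B, pure_sub m B,
        forall n, (L n :&: B n = 0)%VS & forall n, (L n + B n = U n)%VS].
Proof.
move=> stL stU LU [kU sU] noU.
case: m => [|m] in kU sU noU *.
  exists (fun => 0%VS); split=> [n p f x | | n | n].
  - by rewrite !memv0 => /eqP->; rewrite linear0.
  - by split=> [n x | x]; rewrite memv0 => /eqP->; rewrite ?linear0 // => -[].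
  - exact: capv0.
  apply/eqP; rewrite addv0 eqEsubv LU; apply/subvP => x /kU.
  by rewrite koszul_deg0 subr0.
pose C := (asym X m.+1 @: U m.+1 :\: L m.+1)%VS.
have CU x : x \in C -> x \in U m.+1.
  move=> Cx; have /memv_imgP[y Uy ->] := subvP (diffvSl _ _) x Cx.
  by rewrite asymE; apply: rpred_sum => s _; rewrite memvZ ?stU.
have sC x : x \in C -> signv x.
  move=> Cx; have /memv_imgP[y _ ->] := subvP (diffvSl _ _) x Cx.
  exact: signv_asym.
pose B n := (\sum_(f : fmor m.+1 n) (rmap X f @: C))%VS.
have memB n (f : fmor m.+1 n) x : x \in C -> rmap X f x \in B n.
  by move=> Cx; apply: (subvP (sumv_sup f isT (subvv _))); rewrite memv_img.
have subB n (T : {vspace X n}) :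
    (forall (f : fmor m.+1 n) x, x \in C -> rmap X f x \in T) -> (B n <= T)%VS.
  move=> CT; apply/subv_sumP => f _.
  by apply/subvP => _ /memv_imgP[x Cx ->]; apply: CT.
have stB : fstable B.
  move=> n p f x Bx.
  suff /subvP/(_ _ Bx) : (B n <= rmap X f @^-1: B p)%VS by rewrite -memv_preim.
  by apply: subB => g y Cy; rewrite -memv_preim -rmap_comp memB.
have BC : (B m.+1 <= C)%VS.
  apply: subB => f x Cx; have [c cE] := endo_signv f.
  by rewrite cE ?memvZ //; apply: sC.
have BU n : (B n <= U n)%VS by apply: subB => f x /CU; apply: stU.
have kB n x : x \in B n -> koszul X n m.+1 x = x.
  move=> Bx; apply/eqP; rewrite -subr_eq0.
  suff /subvP/(_ _ Bx) : (B n <= lker (koszul X n m.+1 - \1)%VF)%VS.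
    by rewrite memv_ker add_lfunE opp_lfunE id_lfunE.
  apply: subB => f y Cy.
  rewrite memv_ker add_lfunE opp_lfunE id_lfunE subr_eq0.
  apply/eqP/koszul_sign_generator; first exact: sC.
  apply: noU (signv_asym _); rewrite asymE; apply: rpred_sum => s _.
  by rewrite memvZ // !stU ?CU.
exists B; split=> //.
- by split=> // x /(subvP BC); apply: sC.
- move=> n; apply/eqP; rewrite -subv0; apply/subvP => x.
  rewrite memv_cap memv0 => /andP[Lx Bx]; rewrite -(kB n x Bx) -memv0.
  apply: koszul_mem => g f; suff -> : rmap X g x = 0 by rewrite linear0 mem0v.
  apply/eqP; rewrite -memv0.
  rewrite -(capv_diff (asym X m.+1 @: U m.+1)%VS (L m.+1)) memv_cap.
  by rewrite stL // (subvP BC) ?stB.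
move=> n; apply/eqP; rewrite eqEsubv subv_add LU BU /=; apply/subvP => x Ux.
rewrite -[x](subrK (koszul X n m.+1 x)).
apply: rpredD; first by apply: subvP (kU n x Ux); apply: addvSl.
apply: koszul_mem => g f.
have : rmap X g x \in (C + L m.+1)%VS.
  have Ugx := stU _ _ g _ Ux.
  rewrite addv_diff -[rmap X g x](subrK ((m.+1)`!%:R^-1 *: asym X _ (rmap X g x))).
  rewrite addrC memv_add ?memvZ ?memv_img //.
  have f0 : (m.+1)`!%:R != 0 :> rat by rewrite pnatr_eq0 -lt0n fact_gt0.
  rewrite -{1}[rmap X g x](scalerK f0) -scalerBr memvZ // -opprB rpredN.
  rewrite asymE scaler_nat -card_Sn -sumr_const -sumrB.
  apply: rpred_sum => s _; rewrite -[X in _ - X](signrZK s).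
  rewrite -scalerBr memvZ //.
  apply: perm_mod_sign => [t l|a b ab]; first exact: stL.
  exact: sU.
case/memv_addP=> c Cc [l Ll ->]; rewrite linearD /= addrC memv_add ?stL //.
exact: memB.
Qed.

Lemma pure_sub_img (X Y : frep) (u : fhom X Y) m (U : forall n, {vspace X n}) :
  pure_sub m U -> pure_sub m (fun n => (u n @: U n)%VS).
Proof.
case=> kU sU; split=> [n _ /memv_imgP[x Ux ->]|_ /memv_imgP[x Ux ->]].
  by rewrite -koszul_nat kU.
exact/signv_nat/sU.
Qed.

Lemma pure_gen (X : frep) m (U : forall n, {vspace X n}) :
  fstable U -> pure_sub m U -> gen_sub m.+1 U.
Proof.
move=> stU [kU _] n; apply/subvP => x Ux; rewrite -(kU n x Ux).
by apply: koszul_mem => g f; rewrite mem_gsub ?stU.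
Qed.

(** * Morphisms and direct sums *)

Section Morphisms.

Lemma hid_nat (V : frep) m n (f : fmor m n) (v : V m) :
  (\1%VF : 'End(V n)) (rmap V f v) = rmap V f ((\1%VF : 'End(V m)) v).
Proof. by rewrite !id_lfunE. Qed.
Definition hid (V : frep) : fhom V V := FHom (@hid_nat V).

Lemma hcomp_nat (U V W : frep) (u : fhom U V) (v : fhom V W)
    m n (f : fmor m n) (x : U m) :
  (v n \o u n)%VF (rmap U f x) = rmap W f ((v m \o u m)%VF x).
Proof. by rewrite !comp_lfunE !fhom_nat. Qed.
Definition hcomp (U V W : frep) (u : fhom U V) (v : fhom V W) : fhom U W :=
  FHom (hcomp_nat u v).

Lemma hzero_nat (V W : frep) m n (f : fmor m n) (v : V m) :
  (0 : 'Hom(V n, W n)) (rmap V f v) = rmap W f ((0 : 'Hom(V m, W m)) v).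
Proof. by rewrite !zero_lfunE linear0. Qed.
Definition hzero (V W : frep) : fhom V W := FHom (@hzero_nat V W).

Section Sum.
Variables V W : frep.

Let fst_at n : 'Hom(fsum V W n, V n) := linfun fst.
Let snd_at n : 'Hom(fsum V W n, W n) := linfun snd.
Fact hfst_nat m n (f : fmor m n) x :
  fst_at n (rmap (fsum V W) f x) = rmap V f (fst_at m x).
Proof. by rewrite !lfunE /= fsum_actE. Qed.
Fact hsnd_nat m n (f : fmor m n) x :
  snd_at n (rmap (fsum V W) f x) = rmap W f (snd_at m x).
Proof. by rewrite !lfunE /= fsum_actE. Qed.
Definition hfst : fhom (fsum V W) V := FHom hfst_nat.
Definition hsnd : fhom (fsum V W) W := FHom hsnd_nat.

Lemma hfstE n (x : fsum V W n) : hfst n x = x.1. Proof. by rewrite lfunE. Qed.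
Lemma hsndE n (x : fsum V W n) : hsnd n x = x.2. Proof. by rewrite lfunE. Qed.

Variables (Z : frep) (u : fhom V Z) (v : fhom W Z).
Let copair_at n : 'Hom(fsum V W n, Z n) :=
  ((u n \o hfst n) + (v n \o hsnd n))%VF.
Fact copairE n (x : fsum V W n) : copair_at n x = u n x.1 + v n x.2.
Proof. by rewrite add_lfunE !comp_lfunE hfstE hsndE. Qed.
Fact copair_nat m n (f : fmor m n) x :
  copair_at n (rmap (fsum V W) f x) = rmap Z f (copair_at m x).
Proof. by rewrite !copairE fsum_actE /= linearD /= !fhom_nat. Qed.
Definition hcopair : fhom (fsum V W) Z := FHom copair_nat.

Lemma hcopairE n (x : fsum V W n) : hcopair n x = u n x.1 + v n x.2.
Proof. exact: copairE. Qed.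

End Sum.

Section Pair.
Variables (Z V W : frep) (u : fhom Z V) (v : fhom Z W).
Let pairf n (x : Z n) : fsum V W n := (u n x, v n x).
Let pair_at n : 'Hom(Z n, fsum V W n) := linfun (@pairf n).
Fact pairE n (x : Z n) : pair_at n x = (u n x, v n x).
Proof. by rewrite [LHS]linfunP // => a y z; rewrite /pairf !linearP. Qed.
Fact pair_nat m n (f : fmor m n) x :
  pair_at n (rmap Z f x) = rmap (fsum V W) f (pair_at m x).
Proof. by rewrite !pairE fsum_actE /= !fhom_nat. Qed.
Definition hpair : fhom Z (fsum V W) := FHom pair_nat.

Lemma hpairE n (x : Z n) : hpair n x = (u n x, v n x).
Proof. exact: pairE. Qed.

End Pair.

End Morphisms.

Lemma fisoI (V W : frep) (u : fhom V W) :
    (forall n x, u n x = 0 -> x = 0) -> (forall n y, exists x, u n x = y) ->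
  fiso V W.
Proof.
move=> ui us; exists u; split=> n; first exact: lker0I (ui n).
by apply/limg_fullP.
Qed.

Lemma fisoE (V W : frep) : fiso V W ->
  exists u : fhom V W, (forall n x, u n x = 0 -> x = 0) /\
                       (forall n y, exists x, u n x = y).
Proof.
case=> u [mu eu]; exists u; split=> [n x | n]; first exact: lker0_eq0.
by apply/limg_fullP.
Qed.

Lemma fiso_refl V : fiso V V.
Proof.
by apply: (@fisoI _ _ (hid V)) => n x => [|]; [|exists x]; rewrite id_lfunE.
Qed.

Lemma fiso_sym V W : fiso V W -> fiso W V.
Proof.
case=> u [mu eu].
have uK n : cancel (u n) (u n)^-1%VF by apply/lker0_lfunK/eqP/mu.
have Ku n : cancel (u n)^-1%VF (u n).
  by move=> y; apply: limg_lfunVK; rewrite eu memvf.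
have nat m n (f : fmor m n) y :
    (u n)^-1%VF (rmap W f y) = rmap V f ((u m)^-1%VF y).
  by apply: (can_inj (uK n)); rewrite Ku fhom_nat Ku.
apply: (@fisoI _ _ (FHom nat)) => n x; first by move=> x0; rewrite -(Ku n x) x0 linear0.
by exists (u n x); apply: uK.
Qed.

Lemma fiso_trans U V W : fiso U V -> fiso V W -> fiso U W.
Proof.
move=> /fisoE[u [ui us]] /fisoE[v [vi vs]].
apply: (@fisoI _ _ (hcomp u v)) => n x; first by rewrite comp_lfunE => /vi/ui.
by have [y <-] := vs n x; have [z <-] := us n y; exists z; rewrite comp_lfunE.
Qed.

Lemma fiso_sum V W V' W' : fiso V V' -> fiso W W' -> fiso (fsum V W) (fsum V' W').
Proof.
move=> /fisoE[u [ui us]] /fisoE[v [vi vs]].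
apply: (@fisoI _ _ (hpair (hcomp (hfst V W) u) (hcomp (hsnd V W) v))) => n.
  case=> x y; rewrite hpairE !comp_lfunE hfstE hsndE.
  by case=> /ui-> /vi->.
case=> x y; have [x' <-] := us n x; have [y' <-] := vs n y.
by exists (x', y'); rewrite hpairE !comp_lfunE hfstE hsndE.
Qed.

Lemma fiso_sum0 V : fiso V (fsum V fzero).
Proof.
apply: (@fisoI _ _ (hpair (hid V) (hzero V fzero))) => n.
  by move=> x; rewrite hpairE id_lfunE => -[].
case=> x y; exists x; rewrite hpairE id_lfunE; congr (_, _).
by rewrite [LHS]thinmx0 [RHS]thinmx0.
Qed.

Lemma fiso_sums_cat s t : fiso (fsum (fsums s) (fsums t)) (fsums (s ++ t)).
Proof.
elim: s => [|V s IH] /=.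
  apply: (@fisoI _ _ (hsnd fzero (fsums t))) => n.
    by case=> x y; rewrite hsndE /= => ->; rewrite [x]thinmx0.
  by move=> y; exists (0, y); rewrite hsndE.
apply: fiso_trans (fiso_sum (fiso_refl V) IH).
apply: (@fisoI _ _ (hpair (hcomp (hfst _ _) (hfst V (fsums s)))
  (hpair (hcomp (hfst _ _) (hsnd V (fsums s))) (hsnd _ (fsums t))))) => n.
  case=> -[x y] z; rewrite !hpairE !comp_lfunE !hfstE !hsndE /=.
  by case=> -> -> ->.
case=> x [y z]; exists ((x, y), z).
by rewrite !hpairE !comp_lfunE !hfstE !hsndE.
Qed.

Lemma rmap_sumE (X Y : frep) m n (f : fmor m n) (x : fsum X Y m) :
  rmap (fsum X Y) f x = (rmap X f x.1, rmap Y f x.2).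
Proof. exact: fsum_actE. Qed.

Definition hinl (X Y : frep) : fhom X (fsum X Y) := hpair (hid X) (hzero X Y).
Definition hinr (X Y : frep) : fhom Y (fsum X Y) := hpair (hzero Y X) (hid Y).

Lemma hinlE (X Y : frep) n x : hinl X Y n x = (x, 0).
Proof. by apply: etrans (hpairE _ _ _) _; rewrite id_lfunE zero_lfunE. Qed.

Lemma hinrE (X Y : frep) n y : hinr X Y n y = (0, y).
Proof. by apply: etrans (hpairE _ _ _) _; rewrite id_lfunE zero_lfunE. Qed.

Lemma gen_lt_sum (X Y : frep) k :
  gen_lt k X -> gen_lt k Y -> gen_lt k (fsum X Y).
Proof.
move=> gX gY n; apply/subvP => -[x y] _.
have -> : (x, y) = hinl X Y n x + hinr X Y n y.
  by rewrite hinlE hinrE; congr (_, _); rewrite ?addr0 ?add0r.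
apply: rpredD.
  by apply: gsub_hom (subvP (gX n) x (memvf x)) => *; rewrite memvf.
by apply: gsub_hom (subvP (gY n) y (memvf y)) => *; rewrite memvf.
Qed.

Lemma gen_lt_fzero k : gen_lt k fzero.
Proof. by move=> n; apply/subvP => x _; rewrite [x]thinmx0 mem0v. Qed.

(** * Classification of pure objects *)

Lemma pure_kop m (X : frep) : pure m X -> forall n (x : X n), koszul X n m x = x.
Proof. by case=> kX _ n x; rewrite kX ?memvf. Qed.

Lemma pure_signv m (X : frep) : pure m X -> forall x : X m, signv x.
Proof. by case=> _ sX x; apply: sX; rewrite memvf. Qed.

Lemma pureI m (X : frep) : (forall n (x : X n), koszul X n m x = x) ->
  (forall x : X m, signv x) -> pure m X.
Proof. by move=> kX sX; split=> [n x|x] _. Qed.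

Lemma pure_cogen m (X : frep) n (x : X n) : pure m X ->
  (forall g : fmor n m, rmap X g x = 0) -> x = 0.
Proof.
move=> pX gx; rewrite -(pure_kop pX x); apply/eqP; rewrite -memv0.
by apply: koszul_mem => g f; rewrite gx linear0 mem0v.
Qed.

(** The operator factors through [m] and no function from [m+1] to [m] is
  injective; hence a pure object has no alternating vector in degree m+1, which
  is what [pure_split] requires. *)
Lemma pure_complement (X : frep) m (T U : forall n, {vspace X n}) :
    fstable T -> fstable U -> (forall n, (T n <= U n)%VS) -> pure_sub m U ->
  exists A : forall n, {vspace X n},
    [/\ fstable A, pure_sub m A,
        forall n, (T n :&: A n = 0)%VS & forall n, (T n + A n = U n)%VS].
Proof.
move=> stT stU TU [kU sU]; apply: pure_split => // [|x Ux sx].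
  split=> [n x Ux | a b ab x Ux]; first by rewrite kU // subrr mem0v.
  by rewrite sU // addNr mem0v.
rewrite -(kU _ x Ux); apply/eqP; rewrite -memv0; apply: koszul_mem => g f.
rewrite (signv_noninj _ sx) ?linear0 ?mem0v //; apply/injectiveP => /leq_card.
by rewrite !card_ord ltnn.
Qed.

Lemma dim_iso (aT rT : vectType rat) : \dim {:aT} = \dim {:rT} ->
  exists (u : 'Hom(aT, rT)) (v : 'Hom(rT, aT)), cancel u v /\ cancel v u.
Proof.
move=> e; have [b bP] : exists b : (\dim {:aT}).-tuple rT, basis_of {:rT} b.
  by rewrite e; exists (vbasis _); apply: vbasisP.
pose f x := \sum_(i < \dim {:aT}) coord (vbasis {:aT}) i x *: b`_i.
have lf : linear f.
  move=> c x y; rewrite /f scaler_sumr -big_split; apply: eq_bigr => i _ /=.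
  by rewrite linearP scalerDl scalerA.
have fker : lker (linfun f) = 0%VS.
  apply: lker0I => x; rewrite linfunP // => fx.
  rewrite (coord_vbasis (memvf x)) big1 // => i _.
  have /freeP/(_ _ fx)-> := basis_free bP; exact: scale0r.
have fK := lker0_lfunK (introT eqP fker).
exists (linfun f), (linfun f)^-1%VF; split=> // y; apply: limg_lfunVK.
have: (limg (linfun f) == fullv)%VS.
  by rewrite eqEdim subvf limg_dim_eq ?e ?leqnn // fker capv0.
by move/eqP->; rewrite memvf.
Qed.

Section PureExtension.
Variables (m : nat) (X Y : frep) (pX : pure m X) (pY : pure m Y).
Variable phi : 'Hom(X m, Y m).

(** The only possible extension of phi, since x is the sum of the images of the
  rmap X p.1 x under the p.2. *)
Let ext n : 'Hom(X n, Y n) :=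
  (\sum_(p <- koszul_pairs n m) (rmap Y p.2 \o phi \o rmap X p.1))%VF.

Let extE n x : ext n x = \sum_(p <- koszul_pairs n m) rmap Y p.2 (phi (rmap X p.1 x)).
Proof.
rewrite /ext; elim: (koszul_pairs n m) => [|p s IH]; first by rewrite !big_nil zero_lfunE.
by rewrite !big_cons add_lfunE IH !comp_lfunE.
Qed.

Let ext_test n (g : fmor n m) x : rmap Y g (ext n x) = phi (rmap X g x).
Proof.
rewrite -[in RHS](pure_kop pX x) koszulE extE !linear_sum; apply: eq_bigr => p _ /=.
have [c cE] := endo_signv (fcomp p.2 g).
rewrite -[LHS]rmap_comp -[rmap X g _]rmap_comp !cE ?linearZ //.
  exact: pure_signv.
exact: pure_signv.
Qed.

Let ext_nat n p (f : fmor n p) x : ext p (rmap X f x) = rmap Y f (ext n x).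
Proof.
apply/eqP; rewrite -subr_eq0; apply/eqP/(pure_cogen pY) => g.
by rewrite linearB /= -rmap_comp !ext_test -rmap_comp subrr.
Qed.

Lemma pure_extension : exists u : fhom X Y,
  forall n (g : fmor n m) x, rmap Y g (u n x) = phi (rmap X g x).
Proof. by exists (FHom ext_nat). Qed.

End PureExtension.

(** A pure object is determined by its lowest value, since both its elements
  and its morphisms are detected by the maps to [m]. *)
Lemma pure_iso m (X Y : frep) : pure m X -> pure m Y ->
  \dim {:X m} = \dim {:Y m} -> fiso X Y.
Proof.
move=> pX pY /dim_iso[phi [psi [phiK psiK]]].
have [u uE] := pure_extension pX pY phi.
have [v vE] := pure_extension pY pX psi.
apply: (@fisoI _ _ u) => n x => [ux0 | ].
  apply: (pure_cogen pX) => g; apply: (can_inj phiK).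
  by rewrite -uE ux0 !linear0.
exists (v n x); apply/eqP; rewrite -subr_eq0; apply/eqP/(pure_cogen pY) => g.
by rewrite linearB /= uE vE psiK subrr.
Qed.

Lemma pure_sum m V W : pure m V -> pure m W -> pure m (fsum V W).
Proof.
move=> pV pW.
have inj n (x y : fsum V W n) :
    hfst V W n x = hfst V W n y -> hsnd V W n x = hsnd V W n y -> x = y.
  by case: x y => [x1 x2] [y1 y2]; rewrite !hfstE !hsndE /= => -> ->.
apply: pureI => [n x | x a b ab]; apply: inj.
- by rewrite koszul_nat (pure_kop pV).
- by rewrite koszul_nat (pure_kop pW).
- by rewrite fhom_nat linearN; apply: (pure_signv pV).
- by rewrite fhom_nat linearN; apply: (pure_signv pW).
Qed.

Lemma pure_zero m : pure m fzero.
Proof. by apply: pureI => [n x|x a b _]; rewrite [LHS]thinmx0 [RHS]thinmx0. Qed.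

Lemma pure_nseq m V b : pure m V -> pure m (fsums (nseq b V)).
Proof.
by move=> pV; elim: b => [|b IH]; [apply: pure_zero | apply: pure_sum].
Qed.

Lemma dim_nseq (V : frep) n b :
  \dim {:fsums (nseq b V) n} = (b * \dim {:V n})%N.
Proof.
elim: b => [|b IH] /=; first by rewrite dimvf.
by rewrite mulSn -IH !dimvf.
Qed.

(** * The objects D_k are pure *)

Lemma fhom_comb (X Y : frep) (u : fhom X Y) m n (c : fmor m n -> rat) x :
  u n (\sum_f c f *: rmap X f x) = \sum_f c f *: rmap Y f (u m x).
Proof.
rewrite linear_sum; apply: eq_bigr => f _.
by rewrite linearZ /= fhom_nat.
Qed.

Section ImageInclusion.
Variables (V W : frep) (u : fhom V W).
Let inc n : 'Hom(fimage u n, W n) := linfun vsval.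
Fact imginc_nat m n (f : fmor m n) (x : fimage u m) :
  inc n (rmap (fimage u) f x) = rmap W f (inc m x).
Proof. by rewrite /inc [LHS]lfunE [X in rmap W f X]lfunE; apply: fimage_actE. Qed.
Definition imginc : fhom (fimage u) W := FHom imginc_nat.
Lemma imgincE n x : imginc n x = vsval x. Proof. by rewrite lfunE. Qed.
Lemma imginc_inj n : injective (imginc n).
Proof. by move=> x y; rewrite !imgincE; apply: val_inj. Qed.
End ImageInclusion.

Section QuotientMap.
Variables (V : frep) (U : forall n, {vspace V n}).
Hypothesis stU : forall m n (f : fmor m n) v, v \in U m -> rmap V f v \in U n.
Let proj n : 'Hom(V n, fquot stU n) := qproj (U n).
Fact quotmap_nat m n (f : fmor m n) (x : V m) :
  proj n (rmap V f x) = rmap (fquot stU) f (proj m x).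
Proof. by rewrite fquot_actE. Qed.
Definition quotmap : fhom V (fquot stU) := FHom quotmap_nat.
Lemma quotmap_eq0 n x : (quotmap n x == 0) = (x \in U n).
Proof. exact: qproj_eq0. Qed.
Lemma quotmap_sur n y : exists x, quotmap n x = y.
Proof. by exists (qrepr (U n) y); apply: qproj_qrepr. Qed.
End QuotientMap.

Lemma rmap_qf_of j m n (g : fmor j m) (f : fmor m n) :
  rmap (QF j) f (qf_of g) = qf_of (fcomp g f).
Proof.
apply/ffunP=> h; rewrite ftens_actE ffunE.
rewrite big_mkcond (bigD1 g) //= big1 => [|x xg].
  by rewrite ffunE eqxx eq_sym addr0; case: eqP.
by rewrite ffunE (negPf xg) if_same.
Qed.

Lemma qf_sum j n (a : QF j n) :
  a = \sum_f (a f : rat) *: rmap (QF j) f (qf_of (fid j)).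
Proof.
apply/ffunP=> h; rewrite sum_ffunE (bigD1 h) //= big1 => [|f fh].
  by rewrite addr0 rmap_qf_of fcomp1f !ffunE eqxx [RHS]mulr1.
by rewrite rmap_qf_of fcomp1f !ffunE eq_sym (negPf fh) [LHS]mulr0.
Qed.

Lemma eps_asym k : eps k = (k`!%:R^-1 : rat) *: asym (QF k) k (qf_of (fid k)).
Proof.
rewrite asymE; congr (_ *: _); apply: eq_bigr => s _.
by rewrite rmap_qf_of fcomp1f.
Qed.

Lemma qcomp_eps p k (a : QF p k) :
  qcomp a (eps k) = (k`!%:R^-1 : rat) *: asym (QF p) k a.
Proof.
pose L : 'Hom(QF k k, QF p k) := linfun (qcomp a).
have LE x : L x = qcomp a x by rewrite linfunP //; apply: qcomp_is_linear.
rewrite -LE linearZ linear_sum asymE; congr (_ *: _); apply: eq_bigr => s _.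
by rewrite linearZ /= LE qcomp_qf_of.
Qed.

Lemma signv_eps k : signv (eps k : QF k k).
Proof. by rewrite eps_asym; apply/signvZ/signv_asym. Qed.

Lemma qcomp_eps_signv p k (a : QF p k) : signv a -> qcomp a (eps k) = a.
Proof.
move=> sa; rewrite qcomp_eps asym_signv // scalerK //.
by rewrite pnatr_eq0 -lt0n fact_gt0.
Qed.

Lemma eps_neq0 k : eps k != 0.
Proof.
apply/eqP => /ffunP/(_ (fid k)); rewrite !ffunE sum_ffunE.
rewrite (bigD1 1%g) //= big1 => [|s s1]; last first.
  rewrite !ffunE; case: eqP => [/ffunP e|_]; last exact: mulr0.
  case/eqP: s1; apply/permP=> i; have := e i.
  by rewrite !ffunE perm1.
rewrite !ffunE fperm1 eqxx odd_perm1 addr0 => /eqP.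
rewrite /GRing.scale /= !mulr1 invr_eq0 pnatr_eq0.
by rewrite -leqn0 leqNgt fact_gt0.
Qed.

Lemma Lam_gen k : exists2 e : Lam k k, imginc _ k e = eps k &
  forall n (x : Lam k n), exists c : fmor k n -> rat,
    x = \sum_f c f *: rmap (Lam k) f e.
Proof.
have e_in : (eps k : QF k k) \in limg (lmul (eps k) k).
  by apply/memv_imgP; exists (eps k); rewrite ?memvf // lmulE
       qcomp_eps_signv //; apply: signv_eps.
exists (vsproj _ (eps k)) => [|n x]; first by rewrite imgincE vsprojK.
have /memv_imgP[h _ xE] := subvsP x; exists h.
apply: (@imginc_inj _ _ (lmul (eps k))).
rewrite fhom_comb !imgincE xE {1}(qf_sum h) fhom_comb; apply: eq_bigr => f _.
by rewrite vsprojK // lmulE qcomp_qf_of rmap_id.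
Qed.

(** The boundary is, up to a factor, the antisymmetrised inclusion, so the
  antisymmetrised image of the generator vanishes in the cokernel. *)
Lemma Drep_gen k : exists2 u : Drep k k, signv u &
  [/\ forall n (x : Drep k n), exists c : fmor k n -> rat,
        x = \sum_f c f *: rmap (Drep k) f u,
      asym (Drep k) k.+1 (rmap (Drep k) (incl k) u) = 0 & u != 0].
Proof.
have [e eE genL] := Lam_gen k; have [e' e'E genL'] := Lam_gen k.+1.
pose q := quotmap (@fcoker_stable _ _ (dmap k)).
have se : signv e.
  by apply: signv_inj (@imginc_inj _ _ _ _) _; rewrite eE; apply: signv_eps.
exists (q k e); first exact: signv_nat.
split=> [n x | | ].
- have [y <-] := quotmap_sur x; have [c ->] := genL n y; exists c.
  by rewrite fhom_comb.
- rewrite -fhom_nat -asym_nat; apply/eqP; rewrite quotmap_eq0.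
  have f0 : k.+1`!%:R != 0 :> rat by rewrite pnatr_eq0 -lt0n fact_gt0.
  suff -> : asym (Lam k) k.+1 (rmap (Lam k) (incl k) e) =
      k.+1`!%:R *: dmap k k.+1 e' by rewrite memvZ // memv_img ?memvf.
  apply: (@imginc_inj _ _ (lmul (eps k))).
  have dE : imginc (lmul (eps k)) k.+1 (dmap k k.+1 e') =
      qcomp (bdry k) (eps k.+1) by rewrite -e'E !imgincE; apply: dmapE.
  rewrite asym_nat fhom_nat eE.
  transitivity (k.+1`!%:R *: imginc (lmul (eps k)) k.+1 (dmap k k.+1 e')).
    rewrite dE /bdry -qcompA (qcomp_eps_signv (@signv_eps _)) qcomp_eps.
    by rewrite qcomp_qf_of scalerKV.
  by rewrite linearZ.
apply: contraNneq (eps_neq0 k) => /eqP; rewrite quotmap_eq0 => /memv_imgP[y _ ey].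
suff y0 : y = 0 by rewrite -eE ey y0 !linear0.
have [c ->] := genL' k y; apply: big1 => f _.
rewrite signv_noninj ?scaler0 //.
  by apply/injectiveP => /leq_card; rewrite !card_ord ltnn.
by apply: signv_inj (@imginc_inj _ _ _ _) _; rewrite e'E; apply: signv_eps.
Qed.

Section CyclicPure.
Variables (X : frep) (m : nat) (u : X m).
Hypotheses (su : signv u) (genu : forall n (x : X n),
  exists c : fmor m n -> rat, x = \sum_f c f *: rmap X f u).

Lemma cyclic_line (x : X m) : x \in <[u]>%VS.
Proof.
have [c ->] := genu x; apply: rpred_sum => f _.
by have [d dE] := endo_signv f; rewrite dE // !memvZ ?memv_line.
Qed.

Lemma cyclic_dim : u != 0 -> \dim {:X m} = 1%N.
Proof.
move=> u0; suff -> : {:X m}%VS = <[u]>%VS by rewrite dim_vline u0.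
by apply/eqP; rewrite eq_sym eqEsubv subvf; apply/subvP => x _; apply: cyclic_line.
Qed.

End CyclicPure.

Lemma cyclic_pure (X : frep) m (u : X m.+1) :
    signv u -> asym X m.+2 (rmap X (incl m.+1) u) = 0 ->
    (forall n (x : X n),
       exists c : fmor m.+1 n -> rat, x = \sum_f c f *: rmap X f u) ->
  pure m.+1 X.
Proof.
move=> su du genu; apply: pureI => [n x | x].
  have [c ->] := genu _ x; rewrite linear_sum; apply: eq_bigr => f _.
  by rewrite linearZ /= koszul_sign_generator.
by have /vlineP[c ->] := cyclic_line su genu x; apply: signvZ.
Qed.

Lemma pure_Drep k : pure k.+1 (Drep k.+1).
Proof.
have [u su [genu du _]] := Drep_gen k.+1; exact: cyclic_pure su du genu.
Qed.

Lemma dim_Drep k : \dim {:Drep k k} = 1%N.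
Proof. by have [u su [genu _ u0]] := Drep_gen k; apply: cyclic_dim su genu u0. Qed.

Lemma pure_classification m (X : frep) : pure m.+1 X ->
  fiso (fsums (nseq (\dim {:X m.+1}) (Drep m.+1))) X.
Proof.
move=> pX; apply: pure_iso pX _; first exact/pure_nseq/pure_Drep.
by rewrite dim_nseq dim_Drep muln1.
Qed.

(** * Sums over the sections of a function *)

Definition upd k n (h : fmor k n) (i : 'I_k) (b : 'I_n) : fmor k n :=
  [ffun j => if j == i then b else h j].

Definition avoids k n (h : fmor k n) (i : 'I_k) : pred 'I_n :=
  fun b => [forall j, (j != i) ==> (h j != b)].

Section Sections.
Variables (V : zmodType) (k n : nat) (F : fmor k n -> V).
Hypothesis F_sections :
  forall g : fmor n k, \sum_(h | fcomp h g == fid k) F h = 0.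

Lemma avoidsP (h : fmor k n) i b :
  reflect (forall j, j != i -> h j != b) (avoids h i b).
Proof. exact: 'forall_implyP. Qed.

Lemma avoids_self (h : fmor k n) i : injective h -> avoids h i (h i).
Proof. by move=> hi; apply/avoidsP => j; rewrite (inj_eq hi). Qed.

Lemma avoids_missing (h : fmor k n) i b : b \notin codom h -> avoids h i b.
Proof. by move=> hb; apply/avoidsP => j _; apply: contraNneq hb => <-; apply: codom_f. Qed.

Lemma upd_self (h : fmor k n) i : upd h i (h i) = h.
Proof. by apply/ffunP=> j; rewrite ffunE; case: eqP => // ->. Qed.

(** The functions [upd h i b] with b avoided by the other values of h are the
  sections of the map that sends h j to j for j != i and every other point to
  i. *)
Lemma sum_upd (h : fmor k n) (i : 'I_k) :
  injective h -> \sum_(b | avoids h i b) F (upd h i b) = 0.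
Proof.
move=> h_inj.
pose g : fmor n k :=
  [ffun x => odflt i [pick j | (j != i) && (h j == x)]].
have g_h j : j != i -> g (h j) = j.
  move=> ji; rewrite ffunE; case: pickP => [l /andP[_ /eqP/h_inj] //|].
  by move/(_ j); rewrite ji eqxx.
have g_else x : avoids h i x = (g x == i).
  apply/avoidsP/eqP => [hx | gx j ji].
    by rewrite ffunE; case: pickP => //= j /andP[ji]; rewrite (negPf (hx j ji)).
  by apply/eqP=> hj; have := g_h j ji; rewrite hj gx => ij; rewrite ij eqxx in ji.
rewrite -[RHS](F_sections g) [RHS](reindex_onto (upd h i) (fun f => f i)) /=.
  apply: eq_bigl => b; rewrite ffunE eqxx eqxx andbT g_else.
  apply/eqP/eqP => [gb | /ffunP/(_ i)].
    apply/ffunP=> j; rewrite [LHS]ffunE [RHS]ffunE [X in g X]ffunE.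
    by case: eqP => [->|/eqP/g_h].
  by rewrite [LHS]ffunE [RHS]ffunE [X in g X]ffunE eqxx.
move=> f /eqP/ffunP fg; apply/ffunP=> j; rewrite ffunE.
case: eqP => [-> //|/eqP ji].
have gf : g (f j) = j by have := fg j; rewrite [LHS]ffunE [RHS]ffunE.
have : ~~ avoids h i (f j) by rewrite g_else gf.
rewrite /avoids negb_forall => /existsP[l]; rewrite negb_imply negbK.
by case/andP=> li /eqP hl; rewrite -hl; congr (h _); rewrite -gf -hl g_h.
Qed.

End Sections.

(** When [h] misses a single point c, moving any value of [h] to c changes the
  sign of F; conjugating by such moves gives all transpositions. *)
Section OneMissing.
Variables (V : zmodType) (k : nat) (F : fmor k k.+1 -> V).
Hypothesis F_sections :
  forall g : fmor k.+1 k, \sum_(h | fcomp h g == fid k) F h = 0.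

Lemma missing_point (h : fmor k k.+1) : injective h ->
  exists2 c, c \notin codom h & forall b, b \notin codom h -> b = c.
Proof.
move=> h_inj; have : #|[predC codom h]| == 1%N.
  have := cardC (mem (codom h)); rewrite (card_codom h_inj) !card_ord.
  by move=> e; apply/eqP/(@addnI k); rewrite e addn1.
case/card1P => c hc; exists c => [|b hb]; first by have := hc c; rewrite !inE eqxx.
by apply/eqP; have := hc b; rewrite !inE hb => <-.
Qed.

Lemma tperm_missing (h : fmor k k.+1) c x : injective h ->
  c \notin codom h -> x != c -> F (fcomp h (fperm (tperm c x))) = - F h.
Proof.
move=> h_inj hc xc; have [c' _ c'P] := missing_point h_inj.
have /codomP[i xE] : x \in codom h.
  by apply: contraNT xc => /c'P->; rewrite (c'P c hc).
have -> : fcomp h (fperm (tperm c x)) = upd h i c.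
  apply/ffunP=> j; rewrite !ffunE; case: eqP => [-> | ji].
    by rewrite -xE tpermR.
  rewrite tpermD //; first by apply: contraNneq hc => ->; apply: codom_f.
  by rewrite xE; apply/eqP => /h_inj/esym.
apply/eqP; rewrite -addr_eq0; apply/eqP.
rewrite -(sum_upd F_sections i h_inj) (bigD1 c) ?avoids_missing //=; congr (_ + _).
rewrite (big_pred1 (h i)) ?upd_self // => b /=.
apply/andP/eqP => [[/avoidsP hb bc] | ->].
  apply/eqP; apply: contraNT bc => bhi; rewrite (c'P c hc); apply/eqP/c'P.
  apply/codomP => -[j bE]; have /hb : j != i by apply: contraNneq bhi => <-; rewrite bE.
  by rewrite bE eqxx.
by rewrite avoids_self // -xE.
Qed.

Lemma sections_alternate (h : fmor k k.+1) (a b : 'I_k.+1) : injective h ->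
  a != b -> F (fcomp h (fperm (tperm a b))) = - F h.
Proof.
move=> h_inj ab; have [c hc cP] := missing_point h_inj.
have [ca | ca] := eqVneq c a.
  by rewrite -ca in ab *; apply: tperm_missing => //; rewrite eq_sym.
have [cb | cb] := eqVneq c b.
  by rewrite -cb in ab *; rewrite tpermC; apply: tperm_missing.
have inj_t (h' : fmor k k.+1) x y :
    injective h' -> injective (fcomp h' (fperm (tperm x y)) : fmor k k.+1).
  by move=> h'_inj i j; rewrite !ffunE => /perm_inj/h'_inj.
pose h1 : fmor k k.+1 := fcomp h (fperm (tperm c a)).
pose h2 : fmor k k.+1 := fcomp h1 (fperm (tperm a b)).
have h1_inj : injective h1 by apply: inj_t.
have h2_inj : injective h2 by apply: inj_t.
have h1a : a \notin codom h1.
  apply: contra hc => /codomP[j]; rewrite !ffunE => aE.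
  by apply/codomP; exists j; apply: (@perm_inj _ (tperm c a)); rewrite -aE tpermL.
have h2b : b \notin codom h2.
  apply: contra h1a => /codomP[j]; rewrite ffunE [fperm _ _]ffunE => bE.
  by apply/codomP; exists j; apply: (@perm_inj _ (tperm a b)); rewrite -bE tpermL.
have <- : fcomp h2 (fperm (tperm b c)) = fcomp h (fperm (tperm a b)).
  apply/ffunP=> j; rewrite !ffunE.
  have : h j != c by apply: contraNneq hc => <-; apply: codom_f.
  have [-> _ | ha] := eqVneq (h j) a.
    by rewrite tpermR [tperm a b c]tpermD 1?eq_sym // tpermR tpermL.
  have [-> _ | hb hjc] := eqVneq (h j) b.
    by rewrite [tperm c a b]tpermD // tpermR [tperm b c a]tpermD // eq_sym.
  by rewrite !tpermD // eq_sym.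
rewrite tperm_missing // ?tperm_missing ?opprK // 1?eq_sym //.
Qed.

End OneMissing.

Section SetSum.
Variables (V : zmodType) (k n : nat) (F : fmor k n.+1 -> V).
Hypothesis F_sections :
  forall g : fmor n.+1 k, \sum_(h | fcomp h g == fid k) F h = 0.
Variable (h : fmor k n.+1).
Hypothesis h_inj : injective h.

Let imh : {set 'I_n.+1} := [set h i | i in 'I_k].

Let card_imh : #|imh| = k. Proof. by rewrite card_imset // card_ord. Qed.

Let mem_imh i : h i \in imh. Proof. exact: imset_f. Qed.

Let retr_eq (S : {set 'I_n.+1}) g : ord0 \in S ->
  fcomp g (retr S) = h -> imh \subset S /\ forall i, h i != ord0 -> g i = h i.
Proof.
move=> S0 gh; split=> [|i].
  apply/subsetP => _ /imsetP[i _ ->]; rewrite -gh !ffunE.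
  by case: ifP.
by rewrite -gh !ffunE; case: ifP => // _; rewrite eqxx.
Qed.

Let outside_sum (S : {set 'I_n.+1}) : ord0 \in S -> ~~ (imh \subset S) ->
  \sum_(g | fcomp g (retr S) == h) F g = 0.
Proof.
by move=> S0 nS; apply: big_pred0 => g; apply/eqP => /(retr_eq S0)[sS _]; rewrite sS in nS.
Qed.

Let based_over : [set S in based_sets n k | imh \subset S] =
  [set a |: imh | a in ~: imh & ord0 \in a |: imh].
Proof.
apply/setP=> S; rewrite !inE; apply/andP/imsetP => [[/andP[S0 /eqP Sk] sS]|].
  have : #|S :\: imh| == 1%N by rewrite cardsDS // Sk card_imh subSnn.
  case/cards1P => a aE; have SE : S = a |: imh.
    rewrite -aE; apply/setP=> x; rewrite !inE.
    by case: (boolP (x \in imh)) => [/(subsetP sS)->|_]; rewrite ?orbT ?orbF.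
  exists a => //; rewrite inE /= in_setC -SE S0 andbT.
  have : a \in S :\: imh by rewrite aE set11.
  by rewrite in_setD => /andP[].
case=> a; rewrite !inE => /andP[ha S0] ->.
by rewrite !inE S0 cardsU1 ha card_imh eqxx subsetUr.
Qed.

Let over_inj : {in ~: imh &, injective (fun a => a |: imh)}.
Proof.
move=> a b; rewrite !inE => ha hb /setP/(_ a); rewrite !inE eqxx (negPf ha) orbF /=.
by rewrite orbF => /esym/eqP.
Qed.

(** Only sets S containing the image of h contribute.  If h misses the base point,
  then S is the image together with the base point, and h is the only g.  If
  h i0 is the base point, then S is the image with one more point a, and the g
  are the [upd h i0 b] with b avoided and different from a; by [sum_upd] they
  contribute - F (upd h i0 a), and by [sum_upd] again these add up to F h. *)
Lemma sections_koszul :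
  \sum_(S in based_sets n k) \sum_(g | fcomp g (retr S) == h) F g = F h.
Proof.
rewrite (bigID (fun S : {set _} => imh \subset S)) /= [X in _ + X]big1 ?addr0; last first.
  by move=> S /andP[]; rewrite inE => /andP[S0 _]; apply: outside_sum.
rewrite (eq_bigl (fun S => S \in [set a |: imh | a in ~: imh & ord0 \in a |: imh])); last first.
  by move=> S; rewrite -based_over [RHS]inE.
rewrite big_imset /=; last first.
  by move=> a b; rewrite !inE => /andP[ha _] /andP[hb _]; apply: over_inj; rewrite inE.
case: (boolP (ord0 \in codom h)) => [/codomP[i0 h0] | h0].
  rewrite (eq_bigl (fun a => a \in ~: imh)); last first.
    by move=> a; rewrite !inE h0 mem_imh orbT andbT.
  transitivity (\sum_(a in ~: imh) - F (upd h i0 a)).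
    apply: eq_bigr => a; rewrite inE => ha.
    have av : avoids h i0 a.
      by apply: avoids_missing; apply: contra ha => /codomP[j ->].
    have := sum_upd F_sections i0 h_inj; rewrite (bigD1 a av) /= => /eqP.
    rewrite addrC addr_eq0 => /eqP <-.
    have S0 : ord0 \in a |: imh by rewrite h0 in_setU mem_imh orbT.
    rewrite (reindex_onto (upd h i0) (fun g => g i0)) /=.
      apply: eq_bigl => b; rewrite ffunE eqxx eqxx andbT.
      apply/eqP/andP => [/ffunP e | [/avoidsP hb ba]].
        have := e i0; rewrite 2!ffunE [upd _ _ _ _]ffunE eqxx -h0 => rb.
        split.
          apply/avoidsP => j; apply: contra => /eqP hj.
          by rewrite -(inj_eq h_inj) -h0 -rb -hj in_setU mem_imh orbT.
        apply: contra ha => /eqP ba; move: rb.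
        by rewrite ba setU11 => ->; rewrite h0 mem_imh.
      apply/ffunP=> j; rewrite 2!ffunE [upd _ _ _ _]ffunE.
      case: eqP => [-> | _]; last by rewrite in_setU mem_imh orbT.
      rewrite -h0 in_setU1 (negPf ba) /=; case: imsetP => // -[l _ bE].
      rewrite bE h0; congr (h _); apply/eqP; apply: contraT => /hb.
      by rewrite bE eqxx.
    move=> g /eqP/(retr_eq S0)[_ gh]; apply/ffunP=> j; rewrite ffunE.
    by case: eqP => [->//|/eqP ji]; rewrite gh // h0 (inj_eq h_inj).
  have := sum_upd F_sections i0 h_inj.
  rewrite (bigD1 (h i0)) ?avoids_self //= upd_self sumrN => /eqP.
  rewrite addr_eq0 => /eqP ->; congr (- _); apply: eq_bigl => b.
  rewrite in_setC; apply/idP/andP => [hb | [/avoidsP hb bi]].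
    split; last by apply: contra hb => /eqP->; apply: mem_imh.
    by apply: avoids_missing; apply: contra hb => /codomP[j ->]; apply: mem_imh.
  apply/imsetP=> -[j _ bE]; case/eqP: bi; rewrite bE; congr (h _).
  by apply/eqP; apply: contraT => /hb; rewrite bE eqxx.
have n0 : ord0 \notin imh.
  by apply: contra h0 => /imsetP[j _ ->]; apply: codom_f.
rewrite (big_pred1 ord0) => [|a]; last first.
  rewrite /= inE in_setC in_setU1 (negPf n0) orbF eq_sym.
  by case: eqP => [->|]; rewrite ?andbT ?andbF.
rewrite (big_pred1 h) // => g /=; apply/eqP/eqP => [|->].
  case/(retr_eq (setU11 _ _)) => _ gh; apply/ffunP=> j; apply: gh.
  by apply: contraNneq n0 => <-; apply: mem_imh.
by apply/ffunP=> j; rewrite !ffunE in_setU mem_imh orbT.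
Qed.
End SetSum.

(** * Schur projectives as invariants *)

Section Tensors.
Variables (U : vectType rat) (j : nat).
Notation T := (ftens U j).

Definition dirac (w : U) : T j := [ffun h => if h == fid j then w else 0].

Lemma tens_sum n (F : T n) : F = \sum_h rmap T h (dirac (F h)).
Proof.
apply/ffunP=> h; rewrite sum_ffunE (bigD1 h) //= big1 => [|g gh].
  rewrite addr0 ftens_actE (bigD1 (fid j)) ?fcomp1f //= big1 ?addr0 => [|g].
    by rewrite ffunE eqxx.
  by case/andP=> _ /negPf gi; rewrite ffunE gi.
rewrite ftens_actE big1 // => f /eqP fgh; rewrite ffunE.
by case: eqP => // f1; rewrite f1 fcomp1f in fgh; rewrite fgh eqxx in gh.
Qed.

Lemma gen_ftens : gen_lt j.+1 (ftens U j).
Proof.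
move=> n; apply/subvP => F _; rewrite (tens_sum F).
by apply: rpred_sum => h _; rewrite mem_gsub ?memvf.
Qed.

End Tensors.

Arguments dirac {U j} w.

(** In characteristic zero invariants and coinvariants agree.  Invariants are
  functions, whose values at injective functions can be tested directly, while
  elements of [schur_at W j] are only classes of functions. *)
Section Invariants.
Variables (W : srep) (j : nat).
Notation T := (ftens (W j) j).

Definition invar n : {vspace T n} := (\bigcap_(s : 'S_j) lker (schur_rel W s n))%VS.

Lemma invP n (F : T n) :
  reflect (forall s h, sact W s (F (fcomp (fperm s) h)) = F h) (F \in invar n).
Proof.
rewrite memvE /invar; apply: (iffP subv_bigcapP) => [FI s h | FI s _].
  have := FI s isT; rewrite -memvE memv_ker => /eqP/ffunP/(_ (fcomp (fperm s) h)).
  rewrite schur_relE ffunE fcompA -fpermM mulVg fperm1 fcomp1f => /eqP.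
  by rewrite subr_eq0 => /eqP.
rewrite -memvE memv_ker; apply/eqP/ffunP=> h; rewrite schur_relE ffunE.
rewrite -(FI s (fcomp (fperm s^-1%g) h)) fcompA -fpermM mulgV fperm1 fcomp1f.
exact: subrr.
Qed.

Lemma inv_stable : @fstable T invar.
Proof.
move=> m n f F FI; rewrite memvE; apply/subv_bigcapP => s _.
have /subv_bigcapP/(_ s isT) : (<[F]> <= invar m)%VS by rewrite -memvE.
by rewrite -!memvE !memv_ker schur_rel_nat => /eqP->; rewrite linear0.
Qed.

Definition Inv : frep := fsubrep inv_stable.

Let avgf n (F : T n) : T n :=
  [ffun h => (j`!%:R^-1 : rat) *: \sum_(s : 'S_j) sact W s (F (fcomp (fperm s) h))].
Definition avg n : 'End(T n) := linfun (@avgf n).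

Lemma avgE n (F : T n) h : avg n F h =
  (j`!%:R^-1 : rat) *: \sum_(s : 'S_j) sact W s (F (fcomp (fperm s) h)).
Proof.
rewrite [avg n F]linfunP ?ffunE // => a x y; apply/ffunP=> k.
rewrite !ffunE [in RHS]scalerA mulrC -scalerA -scalerDr; congr (_ *: _).
rewrite scaler_sumr -big_split; apply: eq_bigr => s _ /=.
by rewrite !ffunE linearP.
Qed.

Let fact0 : j`!%:R != 0 :> rat.
Proof. by rewrite pnatr_eq0 -lt0n fact_gt0. Qed.

Lemma avg_inv n (F : T n) : avg n F \in invar n.
Proof.
apply/invP => t h; rewrite !avgE linearZ linear_sum; congr (_ *: _).
rewrite [RHS](reindex_inj (mulIg t)) /=; apply: eq_bigr => s _.
by rewrite sact_comp fpermM fcompA.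
Qed.

Lemma avg_id n (F : T n) : F \in invar n -> avg n F = F.
Proof.
move/invP=> FI; apply/ffunP=> h; rewrite avgE.
under eq_bigr do rewrite FI.
by rewrite sumr_const card_Sn -scaler_nat scalerK.
Qed.

Lemma avg_rel n (F : T n) : F \in schur_relations W j n -> avg n F = 0.
Proof.
case/memv_sumP=> G GP ->; rewrite linear_sum; apply: big1 => t _.
have /memv_imgP[{}F _ ->] := GP t isT; apply/ffunP=> h.
rewrite avgE ffunE; apply/eqP; rewrite scaler_eq0; apply/orP; right.
under eq_bigr do rewrite schur_relE linearB /= -sact_comp fcompA -fpermM.
rewrite sumrB subr_eq0; apply/eqP.
rewrite [RHS](reindex_inj (mulgI t)) /=; apply: eq_bigr => s _.
by rewrite mulKg.
Qed.

Lemma avg_mod_rel n (F : T n) : F - avg n F \in schur_relations W j n.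
Proof.
have -> : F - avg n F = (j`!%:R^-1 : rat) *:
    \sum_(s : 'S_j) - schur_rel W s n [ffun h => F (fcomp (fperm s) h)].
  apply/ffunP=> h; rewrite !ffunE avgE sum_ffunE -{1}[F h](scalerK fact0).
  rewrite -scalerBr; congr (_ *: _).
  rewrite scaler_nat -card_Sn -sumr_const -sumrB; apply: eq_bigr => s _.
  rewrite ffunE schur_relE !ffunE opprB fcompA -fpermM mulgV fperm1 fcomp1f //.
rewrite memvZ //; apply: memv_sumr => s _.
by rewrite rpredN memv_img ?memvf.
Qed.

Lemma avg_nat m n (f : fmor m n) (F : T m) :
  avg n (rmap T f F) = rmap T f (avg m F).
Proof.
rewrite -[RHS]avg_id ?inv_stable ?avg_inv //; apply/eqP.
rewrite -subr_eq0 -!linearB /=; apply/eqP/avg_rel/schur_relations_stable.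
exact: avg_mod_rel.
Qed.

Lemma fiso_Inv : fiso Inv (schur_at W j).
Proof.
pose q := quotmap (@schur_relations_stable W j).
apply: (@fisoI _ _ (hcomp (fsubinc inv_stable) q)) => n y.
  rewrite comp_lfunE => /eqP; rewrite quotmap_eq0 => /avg_rel y0.
  apply: (@fsubinc_inj _ _ inv_stable).
  by rewrite linear0 -(avg_id (fsubinc_mem y)).
have [F <-] := quotmap_sur y.
have [x xE] := fsubinc_lift inv_stable (avg_inv F); exists x.
rewrite comp_lfunE xE; apply/eqP; rewrite -subr_eq0 -linearB quotmap_eq0.
by rewrite -opprB rpredN avg_mod_rel.
Qed.

Lemma inv_sum n (F : T n) : F \in invar n ->
  F = \sum_h rmap T h (avg j (dirac (F h))).
Proof.
move=> FI; rewrite -{1}(avg_id FI) {1}(tens_sum F) linear_sum.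
by apply: eq_bigr => h _; apply: avg_nat.
Qed.

Lemma gen_Inv : gen_lt j.+1 Inv.
Proof.
move=> n; apply/subvP => x _.
have xE := inv_sum (fsubinc_mem x).
have -> : x = \sum_h rmap Inv h (vsproj (invar j) (avg j (dirac (fsubinc inv_stable n x h)))).
  apply: (@fsubinc_inj _ _ inv_stable); rewrite {1}xE linear_sum.
  apply: eq_bigr => h _.
  set y := vsproj _ _; transitivity (fsubinc inv_stable n (rmap Inv h y)) => //.
  have yE : fsubinc inv_stable j y = avg j (dirac (fsubinc inv_stable n x h)).
    by rewrite fsubincE vsprojK ?avg_inv.
  by rewrite fhom_nat yE.
by apply: rpred_sum => h _; rewrite mem_gsub ?memvf.
Qed.

End Invariants.

Lemma noninj_factor k n (h : fmor k n) : ~~ injectiveb h ->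
  exists l (g : fmor k l) (f : fmor l n), (l < k)%N /\ h = fcomp g f.
Proof.
case/injectivePn=> a [b ab hab]; case: k h a b ab hab => [|k] h a b ab hab.
  by case: a {ab hab}.
have /unlift_some[a' aE _] : b != a by rewrite eq_sym.
exists k, [ffun i => odflt a' (unlift b i)], [ffun i => h (lift b i)].
split=> //; apply/ffunP=> i; rewrite !ffunE.
by case: (unliftP b i) => [i'|] -> //=; rewrite -hab aE.
Qed.

Lemma noninj_gsub (X : frep) (U : forall n, {vspace X n}) k n (h : fmor k n) x :
  fstable U -> ~~ injectiveb h -> x \in U k -> rmap X h x \in gsub k U n.
Proof.
move=> stU /noninj_factor[l [g [f [lk ->]]]] Ux.
by rewrite rmap_comp mem_gsub ?stU.
Qed.

(** * The Schur cover of a functor *)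

Section EquivariantComplement.
Variables (V : frep) (j : nat) (U : {vspace V j}).
Hypothesis stU : forall (s : 'S_j) v, v \in U -> rmap V (fperm s) v \in U.

(** j! times the equivariant projection onto U. *)
Definition eqproj : 'End(V j) :=
  \sum_(s : 'S_j) (rmap V (fperm s^-1%g) \o projv U \o rmap V (fperm s))%VF.

Definition ecompl : {vspace V j} := lker eqproj.

Let eqprojE v : eqproj v =
  \sum_(s : 'S_j) rmap V (fperm s^-1%g) (projv U (rmap V (fperm s) v)).
Proof. by rewrite sum_lfunE; apply: eq_bigr => s _; rewrite !comp_lfunE. Qed.

Let eqproj_in v : eqproj v \in U.
Proof. by rewrite eqprojE; apply: rpred_sum => s _; rewrite stU ?memv_proj. Qed.

Let eqproj_id v : v \in U -> eqproj v = j`!%:R *: v.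
Proof.
move=> Uv; rewrite eqprojE (eq_bigr (fun => v)) => [|s _].
  by rewrite sumr_const card_Sn scaler_nat.
by rewrite projv_id ?stU // -rmap_comp -fpermM mulgV fperm1 rmap_id.
Qed.

Let fact0 : j`!%:R != 0 :> rat.
Proof. by rewrite pnatr_eq0 -lt0n fact_gt0. Qed.

Lemma ecompl_stable (t : 'S_j) v : v \in ecompl -> rmap V (fperm t) v \in ecompl.
Proof.
rewrite !memv_ker => /eqP v0; apply/eqP.
suff -> : eqproj (rmap V (fperm t) v) = rmap V (fperm t) (eqproj v).
  by rewrite v0 linear0.
rewrite !eqprojE linear_sum (reindex_inj (mulgI t^-1%g)) /=.
apply: eq_bigr => s _.
by rewrite -!rmap_comp -!fpermM mulKVg invMg invgK.
Qed.

Lemma ecompl_cap v : v \in ecompl -> v \in U -> v = 0.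
Proof.
rewrite memv_ker => /eqP e Uv; move: e; rewrite eqproj_id // => /eqP.
by rewrite scaler_eq0 (negPf fact0) => /eqP.
Qed.

Lemma ecompl_add v : exists2 u, u \in U & v - u \in ecompl.
Proof.
exists ((j`!%:R^-1 : rat) *: eqproj v); first by rewrite memvZ.
by rewrite memv_ker linearB linearZ /= [eqproj (eqproj v)]eqproj_id // scalerK ?subrr.
Qed.

End EquivariantComplement.

Section Cover.
Variable V : frep.

Definition lower k n : {vspace V n} := gsub k (fun n => fullv) n.

Lemma lower_stable k : fstable (lower k).
Proof. exact: gsub_stable. Qed.

Lemma lower_low k n v : (n < k)%N -> v \in lower k n.
Proof. by move=> nk; rewrite mem_gsub_id ?memvf. Qed.

(** New generators in degree j: a complement of what lower degrees produce. *)
Definition gens j : {vspace V j} := ecompl (lower j j).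

Let gens_stable j (s : 'S_j) v : v \in gens j -> rmap V (fperm s) v \in gens j.
Proof. by apply: ecompl_stable. Qed.

Let gob j : vectType rat := subvs_of (gens j).
Let gact j (s : 'S_j) : 'End(gob j) :=
  (linfun (vsproj (gens j)) \o rmap V (fperm s) \o linfun vsval)%VF.
Fact gactE j (s : 'S_j) (w : gob j) :
  vsval (gact s w) = rmap V (fperm s) (vsval w).
Proof. by rewrite !comp_lfunE !lfunE /= vsprojK // gens_stable ?subvsP. Qed.
Fact gact_id j (w : gob j) : gact 1%g w = w.
Proof. by apply: val_inj; rewrite /= gactE fperm1 rmap_id. Qed.
Fact gact_comp j (s t : 'S_j) (w : gob j) : gact (s * t)%g w = gact t (gact s w).
Proof. by apply: val_inj; rewrite /= !gactE fpermM rmap_comp. Qed.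
Definition Gens : srep := SRep gact_id gact_comp.

Definition gval j : 'Hom(Gens j, V j) := linfun vsval.

Let gvalE j (w : Gens j) : gval j w = vsval (w : gob j).
Proof. by rewrite [LHS]lfunE. Qed.

Lemma gval_act j (s : 'S_j) (w : Gens j) :
  gval j (sact Gens s w) = rmap V (fperm s) (gval j w).
Proof. by rewrite !gvalE; apply: gactE. Qed.

Lemma gval_mem j (w : Gens j) : gval j w \in gens j.
Proof. by rewrite gvalE subvsP. Qed.

Lemma gval_eq0 j (w : Gens j) : gval j w = 0 -> w = 0.
Proof. by rewrite gvalE => w0; apply: val_inj. Qed.

Lemma gval_lift j v : v \in gens j -> exists w : Gens j, gval j w = v.
Proof. by move=> gv; exists (vsproj (gens j) v); rewrite gvalE vsprojK. Qed.

Section Evaluation.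
Variable j : nat.
Notation T := (ftens (Gens j) j).

Let evf n (F : T n) : V n := \sum_(h : fmor j n) rmap V h (gval j (F h)).
Let ev_at n : 'Hom(T n, V n) := linfun (@evf n).
Fact evE n (F : T n) : ev_at n F = \sum_(h : fmor j n) rmap V h (gval j (F h)).
Proof.
rewrite [LHS]linfunP // => a x y; rewrite /evf scaler_sumr -big_split.
by apply: eq_bigr => h _; rewrite !ffunE !linearP.
Qed.
Fact ev_nat m n (f : fmor m n) (F : T m) :
  ev_at n (rmap T f F) = rmap V f (ev_at m F).
Proof.
rewrite !evE linear_sum [RHS](partition_big (fun g => fcomp g f) predT) //=.
apply: eq_bigr => h _; rewrite ftens_actE !linear_sum.
by apply: eq_bigr => g /eqP <-; rewrite /= rmap_comp.
Qed.
Definition hev : fhom T V := FHom ev_nat.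
Lemma hevE n (F : T n) : hev n F = \sum_(h : fmor j n) rmap V h (gval j (F h)).
Proof. exact: evE. Qed.

End Evaluation.

Lemma hev_rel j n (F : ftens (Gens j) j n) :
  F \in schur_relations Gens j n -> hev j n F = 0.
Proof.
case/memv_sumP=> G GP ->; rewrite linear_sum; apply: big1 => s _ /=.
have /memv_imgP[{}F _ ->] := GP s isT; rewrite hevE.
under eq_bigr do rewrite schur_relE !linearB /= gval_act -rmap_comp.
rewrite sumrB; apply/eqP; rewrite subr_eq0; apply/eqP.
rewrite [RHS](reindex_inj (h := fcomp (fperm s))) /=.
  by apply: eq_bigr => h _; rewrite !fcompA -fpermM mulVg fperm1 fcomp1f.
move=> g h /(congr1 (fcomp (fperm s^-1%g))).
by rewrite !fcompA -fpermM mulVg fperm1 !fcomp1f.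
Qed.

Lemma hev_dirac j (w : Gens j) : hev j j (avg Gens j j (dirac w)) = gval j w.
Proof.
apply/eqP; rewrite -subr_eq0; apply/eqP.
have := hev_rel (avg_mod_rel (dirac w)); rewrite linearB /= => /eqP.
rewrite subr_eq0 => /eqP <-; rewrite hevE (bigD1 (fid j)) //= big1 => [|h hj].
  by rewrite ffunE eqxx rmap_id addr0 subrr.
by rewrite ffunE (negPf hj) !linear0.
Qed.

Lemma hev_lower j n (F : ftens (Gens j) j n) : hev j n F \in lower j.+1 n.
Proof.
by rewrite hevE; apply: rpred_sum => h _; rewrite mem_gsub ?memvf.
Qed.

(** By invariance every injective h contributes the value of F at the identity, and
  noninjective h contribute elements generated in lower degrees; so this value
  lies in the intersection of [lower j j] and its complement [gens j]. *)
Lemma hev_minimal j (F : ftens (Gens j) j j) :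
  F \in invar Gens j j -> hev j j F \in lower j j -> F (fid j) = 0.
Proof.
move=> /invP FI; rewrite hevE (bigID (fun h : fmor j j => injectiveb h)) /=.
rewrite (eq_bigr (fun => gval j (F (fid j)))) => [|h /injectiveP h_inj]; last first.
  have -> : h = fperm (perm h_inj) by apply/ffunP=> i; rewrite ffunE permE.
  by rewrite -(FI (perm h_inj) (fid j)) fcompf1 gval_act.
rewrite rpredDr; last first.
  apply: rpred_sum => h hn.
  by apply: noninj_gsub => //; rewrite ?memvf // => ? *; rewrite memvf.
rewrite sumr_const => FL.
have N0 : #|[pred h : fmor j j | injectiveb h]|%:R != 0 :> rat.
  rewrite pnatr_eq0 -lt0n; apply/card_gt0P; exists (fid j).
  by rewrite inE; apply/injectiveP => a b; rewrite !ffunE.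
apply: gval_eq0; apply: (ecompl_cap (U := lower j j)).
- by move=> s v; apply: lower_stable.
- exact: gval_mem.
by rewrite -[gval j _](scalerK N0) memvZ // scaler_nat.
Qed.

Fixpoint fcover k : frep :=
  if k is k'.+1 then fsum (fcover k') (Inv Gens k') else fzero.

Definition hevI k : fhom (Inv Gens k) V :=
  hcomp (fsubinc (inv_stable (W := Gens) (j := k))) (hev k).

Fixpoint cover_map k : fhom (fcover k) V :=
  if k is k'.+1 then hcopair (cover_map k') (hevI k')
  else hzero fzero V.

Lemma cover_mapS k n (x : fcover k.+1 n) :
  cover_map k.+1 n x = cover_map k n x.1 + hev k n (vsval x.2).
Proof.
apply: etrans (hcopairE (cover_map k) (hevI k) x) _.
by rewrite comp_lfunE fsubincE.
Qed.

Lemma lower_mono k l n : (k <= l)%N -> (lower k n <= lower l n)%VS.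
Proof. by move=> kl; apply: gsub_mono. Qed.

Lemma cover_map_lower k n (x : fcover k n) : cover_map k n x \in lower k n.
Proof.
elim: k x => [|k IH] x; first by rewrite zero_lfunE mem0v.
rewrite cover_mapS rpredD ?hev_lower //.
exact: subvP (lower_mono n (leqnSn k)) _ (IH _).
Qed.

Lemma cover_map_onto k n v : v \in lower k n -> exists x, cover_map k n x = v.
Proof.
elim: k n v => [|k IH] n v.
  by rewrite /lower /gsub big_ord0 memv0 => /eqP->; exists 0; rewrite linear0.
have onto j (f : fmor j n) w : (j < k.+1)%N ->
    rmap V f w \in limg (cover_map k.+1 n).
  move=> jk; suff [x <-] : exists x, cover_map k.+1 j x = w.
    by rewrite -fhom_nat memv_img ?memvf.
  have lift u : u \in lower k j -> exists x, cover_map k.+1 j x = u.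
    by case/IH=> x xE; exists (x, 0); rewrite cover_mapS xE !linear0 addr0.
  move: jk; rewrite ltnS leq_eqVlt => /orP[/eqP jk | jk]; last exact/lift/lower_low.
  rewrite {}jk in f w lift *.
  have [u /lift[x xE] cu] := ecompl_add (fun s => @lower_stable k k k (fperm s)) w.
  have [c cE] := gval_lift cu.
  have [y yE] := fsubinc_lift (inv_stable (j:=k)) (avg_inv (dirac c)).
  have yV : vsval y = avg Gens k k (dirac c) by rewrite -yE fsubincE.
  exists (x + (0, y)); have -> : cover_map k.+1 k (x + (0, y)) =
      cover_map k.+1 k x + cover_map k.+1 k (0, y) by apply: linearD.
  rewrite xE.
  by rewrite (cover_mapS (0, y)) linear0 add0r yV hev_dirac cE addrC subrK.
move=> vL; have /subvP/(_ _ vL) : (lower k.+1 n <= limg (cover_map k.+1 n))%VS.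
  by apply: gsub_sub => j f w jk _; apply: onto.
by case/memv_imgP=> x _ ->; exists x.
Qed.

Lemma gen_fcover k : gen_lt k (fcover k).
Proof.
elim: k => [|k IH]; first exact: gen_lt_fzero.
exact: gen_lt_sum (gen_lt_mono (leqnSn k) IH) (@gen_Inv _ _).
Qed.

Lemma fcover_schur k : fiso (fcover k) (fsums [seq schur_at Gens j | j <- iota 0 k]).
Proof.
elim: k => [|k IH]; first exact: fiso_refl.
rewrite -[in iota _ _]addn1 iotaD map_cat add0n.
apply: fiso_trans (fiso_sums_cat _ _); apply: fiso_sum IH _.
exact: fiso_trans (fiso_Inv _ _) (fiso_sum0 _).
Qed.

Lemma Gens_supported k : gen_lt k.+1 V -> supported k Gens.
Proof.
move=> gV j kj; suff g0 : gens j = 0%VS.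
  by rewrite dimvf; change (\dim (gens j) = 0%N); rewrite g0 dimv0.
apply/eqP; rewrite -subv0; apply/subvP => v gv; rewrite memv0; apply/eqP.
apply: ecompl_cap gv _; first by move=> s w; apply: lower_stable.
exact: subvP (lower_mono j kj) _ (subvP (gV j) _ (memvf v)).
Qed.

Lemma fcover_inj0 k n (f : fmor 0 n) x : rmap (fcover k) f x = 0 -> x = 0.
Proof.
elim: k x => [|k IH] x; first by rewrite [x]thinmx0.
rewrite (@rmap_sumE (fcover k) (Inv Gens k)); case: x => x y [/IH-> y0]; congr (_, _).
apply: (@fsubinc_inj _ _ (inv_stable (j:=k))); rewrite linear0.
have := congr1 (fsubinc (inv_stable (j:=k)) n) y0.
rewrite fhom_nat linear0 => /ffunP F0; apply/ffunP=> h.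
have := F0 (fcomp h f); rewrite ftens_actE !ffunE (big_pred1 h) // => g /=.
by rewrite (_ : g = h) ?eqxx //; apply/ffunP=> i; case: (h i).
Qed.

End Cover.

(** * The kernel of the cover *)

Section Noninjective.
Variables (U : vectType rat) (j : nat).
Notation T := (ftens U j).
Let restr n (F : T n) : T n := [ffun h : fmor j n => if injectiveb h then F h else 0].
Definition noninj n : {vspace T n} := lker (linfun (@restr n)).

Lemma noninjP n (F : T n) :
  reflect (forall h : fmor j n, injectiveb h -> F h = 0) (F \in noninj n).
Proof.
rewrite memv_ker linfunP => [|a x y]; last first.
  apply/ffunP=> h; rewrite !ffunE; case: ifP => // _.
  by rewrite scaler0 addr0.
apply: (iffP eqP) => [/ffunP F0 h h_inj | F0].
  by have := F0 h; rewrite !ffunE h_inj.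
by apply/ffunP=> h; rewrite !ffunE; case: ifP => // /F0.
Qed.

Lemma noninj_stable : fstable noninj.
Proof.
move=> m n f F /noninjP F0; apply/noninjP => h /injectiveP h_inj.
rewrite ftens_actE big1 // => g /eqP gf; apply/F0/injectiveP => a b gab.
by apply: h_inj; rewrite -gf !ffunE gab.
Qed.

End Noninjective.

Section Kernel.
Variable V : frep.
Notation W := (Gens V).

Definition cover_ker k n : {vspace fcover V k n} := lker (cover_map V k n).

Section Step.
Variable k : nat.
Notation X := (fcover V k.+1).
Notation K := (cover_ker k.+1).

Let top : fhom X (ftens (W k) k) :=
  hcomp (hsnd (fcover V k) (Inv W k)) (fsubinc (inv_stable (W := W) (j := k))).

Let topE n (x : X n) : top n x = vsval x.2.
Proof. by rewrite comp_lfunE hsndE fsubincE. Qed.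

(** Its elements have a top component supported on noninjective functions; the
  quotient K / K1 is the pure part of type k+1. *)
Let K1 n : {vspace X n} := (K n :&: top n @^-1: noninj (W k) k n)%VS.

Let stK : fstable K. Proof. exact: (@lker_stable _ _ (cover_map V k.+1)). Qed.

Let stK1 : fstable K1.
Proof. exact: capv_stable stK (preim_stable (noninj_stable (j:=k))). Qed.

Let K1P n (x : X n) : reflect
  (x \in K n /\ forall h : fmor k n, injectiveb h -> top n x h = 0) (x \in K1 n).
Proof.
rewrite memv_cap -memv_preim.
by apply: (iffP andP) => -[Kx /noninjP x0].
Qed.

Let top_sections n (x : X n) : x \in K n ->
  forall g : fmor n k, \sum_(h | fcomp h g == fid k) top n x h = 0.
Proof.
move=> Kx g; have := stK g Kx; rewrite memv_ker cover_mapS addrC addr_eq0.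
move=> /eqP e; have tI : top k (rmap X g x) \in invar W k k by rewrite topE subvsP.
transitivity (rmap (ftens (W k) k) g (top n x) (fid k)); first by rewrite ftens_actE.
rewrite -fhom_nat; apply: (hev_minimal tI).
by rewrite topE e rpredN cover_map_lower.
Qed.

Let top_pure : pure_mod k.+1 K1 K.
Proof.
split=> [n x Kx | a b ab x Kx].
  have Kkx : koszul X n k.+1 x \in K n by apply: koszul_mem => g f; rewrite !stK.
  apply/K1P; split=> [|h /injectiveP h_inj]; first exact: rpredB.
  rewrite homB koszul_nat ffunE [X in _ + X]ffunE.
  case: n x Kx {Kkx} h h_inj => [|n] x Kx h h_inj.
    rewrite koszulE big_nil ffunE subr0.
    have no_arg (i : 'I_k) : False by case: (h i).
    pose g : fmor 0 k := [ffun i : 'I_0 => False_rect _ (notF (ltn_ord i))].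
    have := top_sections Kx g; rewrite (big_pred1 h) // => f /=.
    by apply/eqP/eqP => _; apply/ffunP=> i; case: (no_arg i).
  rewrite koszul_retr sum_ffunE.
  under eq_bigr do rewrite ftens_actE.
  by rewrite (sections_koszul (top_sections Kx) h_inj) subrr.
apply/K1P; split=> [|h /injectiveP h_inj]; first by rewrite rpredD ?stK.
rewrite homD fhom_nat ffunE ftens_actE.
rewrite (big_pred1 (fcomp h (fperm (tperm a b)))) => [|g /=].
  by rewrite (sections_alternate (top_sections Kx) h_inj ab) addNr.
apply/eqP/eqP => [<-|->]; rewrite -fcompA -fpermM tperm2 fperm1 fcompf1 //.
Qed.

Let no_sign_top (x : X k.+2) : x \in K k.+2 -> signv x -> x = 0.
Proof. by move=> _; apply: no_signv (gen_fcover V k.+1) (ltnSn _). Qed.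

Variables N' B' : forall n, {vspace fcover V k n}.
Hypothesis stB' : fstable B'.
Hypotheses (genN' : gen_sub k N') (pureB' : pure_sub k B').
Hypothesis kerE : forall n, (N' n + B' n = cover_ker k n)%VS.

Let inX := hinl (fcover V k) (Inv W k).
Let B0 n := (inX n @: B' n)%VS.
Let N0 n := gsub k K1 n.

Let inX_K1 n p : p \in cover_ker k n -> inX n p \in K1 n.
Proof.
rewrite memv_ker => /eqP p0; apply/K1P; split=> [|h _].
  by rewrite memv_ker cover_mapS hinlE p0 linear0 addr0.
by rewrite topE hinlE ffunE.
Qed.

Let B0_K1 n : (B0 n <= K1 n)%VS.
Proof.
apply/subvP => _ /memv_imgP[b Bb ->]; apply: inX_K1; rewrite -kerE.
exact: subvP (addvSr _ _) _ Bb.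
Qed.

Let N0_K1 n : (N0 n <= K1 n)%VS. Proof. exact: gsub_le. Qed.

(** The top component of an element of K1 is a sum of terms attached to
  noninjective h.  Each comes from a value at some [l] with l < k, where all of V
  is generated in degrees below k, so that it can be completed to an element of
  the kernel. *)
Let lift_top n (x : X n) : x \in K1 n ->
  exists2 y, y \in N0 n & top n y = top n x.
Proof.
case/K1P=> _ x0; have xI : top n x \in invar W k n by rewrite topE subvsP.
have : top n x \in (top n @: N0 n)%VS.
  rewrite (inv_sum xI); apply: rpred_sum => h _.
  case: (boolP (injectiveb h)) => hn.
    rewrite x0 // (_ : dirac 0 = 0) ?linear0 ?mem0v //.
    by apply/ffunP=> f; rewrite !ffunE; case: eqP.
  have [l [g [f [lk ->]]]] := noninj_factor hn; rewrite rmap_comp.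
  set z := rmap _ g _.
  have zI : z \in invar W k l by apply: inv_stable (avg_inv _).
  have [p pE] := cover_map_onto (lower_low (- hev V k l z) lk).
  have [G GE] := fsubinc_lift (inv_stable (W := W) (j := k)) zI.
  have GV : vsval G = z by rewrite -GE fsubincE.
  have yz : top l (p, G) = z by rewrite topE.
  rewrite -yz -fhom_nat memv_img // mem_gsub //; apply/K1P; split.
    by rewrite memv_ker cover_mapS pE GV addNr.
  move=> h' /injectiveP/leq_card; rewrite !card_ord.
  by rewrite leqNgt lk.
by case/memv_imgP=> y Ny e; exists y.
Qed.

(** Subtracting a lift of the top component leaves an element of the kernel for the
  generators of degree below k. *)
Let K1_split n : (N0 n + B0 n = K1 n)%VS.
Proof.
apply/eqP; rewrite eqEsubv subv_add N0_K1 B0_K1 /=; apply/subvP => x K1x.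
have [y Ny yx] := lift_top K1x.
have K1xy := rpredB K1x (subvP (N0_K1 n) y Ny).
have [p pE] : exists p, x - y = inX n p.
  exists (x - y).1; rewrite hinlE.
  have : vsval (x - y).2 = 0 by rewrite -topE homB yx subrr.
  by case: (x - y) => p G /= G0; congr (_, _); apply: val_inj.
have : p \in (N' n + B' n)%VS.
  rewrite kerE memv_ker; have /K1P[] := K1xy.
  by rewrite pE memv_ker cover_mapS hinlE linear0 addr0.
case/memv_addP=> u Nu [b Bb pub].
rewrite -[x](subrK y) pE pub homD addrAC memv_add ?memv_img // rpredD //.
change (inX n u \in gsub k K1 n).
apply: gsub_hom (subvP (genN' n) u Nu) => j v _ Nv; apply: inX_K1.
by rewrite -kerE; apply: subvP (addvSl _ _) _ Nv.
Qed.

(** B comes from the quotient K / K1, and A is a complement in B0 of its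
  intersection with N0. *)
Lemma kernel_step : exists M A B : forall n, {vspace X n},
  [/\ fstable M, fstable A, fstable B &
   [/\ gen_sub k M, pure_sub k A & pure_sub k.+1 B] /\
   [/\ forall n, (M n :&: A n = 0)%VS, forall n, ((M n + A n) :&: B n = 0)%VS &
       forall n, (M n + A n + B n = K n)%VS]].
Proof.
have stB0 : fstable B0 by apply: img_stable.
have stN0 : fstable N0 by apply: gsub_stable.
have pB0 : pure_sub k B0 by apply: pure_sub_img.
have [B [stB pB K1B K1BK]] :=
  pure_split stK1 stK (fun n => capvSl _ _) top_pure no_sign_top.
have stT := capv_stable stN0 stB0.
have [A [stA pA TA TAB]] := pure_complement stT stB0 (fun n => capvSr _ _) pB0.
have AB0 n : (A n <= B0 n)%VS by rewrite -TAB addvSr.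
have N0A n : (N0 n + A n = K1 n)%VS.
  rewrite -K1_split -TAB addvA; congr (_ + _)%VS.
  by apply/esym/addv_idPl; apply: capvSl.
exists N0, A, B; split=> //; split; [split=> // n | split=> n].
- by apply: gsub_mono => // j jk; apply/subvP => x; apply: mem_gsub_id.
- apply/eqP; rewrite -subv0 -(TA n) subv_cap capvSr andbT subv_cap capvSl.
  exact: subv_trans (capvSr _ _) (AB0 n).
- by rewrite N0A.
by rewrite N0A.
Qed.

End Step.

(** In the induction M + A plays the part of N', as a pure object of type k is
  generated in degree k. *)
Lemma kernel_structure k : exists M A B : forall n, {vspace fcover V k.+1 n},
  [/\ fstable M, fstable A, fstable B &
   [/\ gen_sub k M, pure_sub k A & pure_sub k.+1 B] /\
   [/\ forall n, (M n :&: A n = 0)%VS, forall n, ((M n + A n) :&: B n = 0)%VS &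
       forall n, (M n + A n + B n = cover_ker k.+1 n)%VS]].
Proof.
suff [N [B [stB gN pB kE]]] : exists N B : forall n, {vspace fcover V k n},
    [/\ fstable B, gen_sub k N, pure_sub k B &
        forall n, (N n + B n = cover_ker k n)%VS].
  exact: kernel_step stB gN pB kE.
elim: k => [|k [N [B [stB gN pB kE]]]].
  exists (fun => 0%VS), (fun => 0%VS).
  have st0 (Y : frep) : @fstable Y (fun => 0%VS).
    by move=> m n f x; rewrite !memv0 => /eqP->; rewrite linear0.
  split=> // [n||n]; first exact: sub0v.
    by split=> [n x|x] _; rewrite [x]thinmx0 ?linear0 // => a b _; rewrite linear0 oppr0.
  by apply/vspaceP => x; rewrite [x]thinmx0 !mem0v.
have [M [A [B' [_ stA stB' [[gM pA pB'] [_ _ kE']]]]]] :=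
  kernel_step stB gN pB kE.
exists (fun n => (M n + A n)%VS), B'; split=> // n; rewrite subv_add; apply/andP; split.
  apply: subv_trans (gM n) (gsub_mono _ (leqnSn k) _) => j _; exact: addvSl.
apply: subv_trans (pure_gen stA pA n) (gsub_mono _ (leqnn _) _) => j _.
exact: addvSr.
Qed.

End Kernel.

(** * Resolutions *)

Lemma fexactP (U V W : frep) (u : fhom U V) (v : fhom V W) :
  fexact u v <-> forall n y, v n y = 0 <-> exists x, u n x = y.
Proof.
split=> [e n y | e n].
  split=> [/eqP | [x <-]].
    by rewrite -memv_ker -e => /memv_imgP[x _ ->]; exists x.
  by apply/eqP; rewrite -memv_ker -e memv_img ?memvf.
apply/vspaceP => y; rewrite memv_ker; apply/memv_imgP/eqP.
  by case=> x _ ->; apply/e; exists x.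
by case/e=> x <-; exists x; rewrite ?memvf.
Qed.

Definition inj0 (V : frep) : Prop :=
  forall n (f : fmor 0 n) (x : V 0%N), rmap V f x = 0 -> x = 0.

Lemma fcover_schur_projective k V :
  gen_lt k.+1 V -> schur_projective k (fcover V k.+1).
Proof.
move=> gV; exists (Gens V); split; first exact: Gens_supported.
exact: fcover_schur.
Qed.

Lemma fcover_epi k V : gen_lt k V -> fepi (cover_map V k).
Proof.
move=> gV n; apply/limg_fullP => y.
by apply: cover_map_onto; apply: subvP (gV n) y (memvf y).
Qed.

Lemma fsubrep_pure_sum (X : frep) m (U : forall n, {vspace X n}) :
    fstable U -> pure_sub m.+1 U ->
  exists a (u : fhom (fsums (nseq a (Drep m.+1))) X),
    (forall n x, u n x = 0 -> x = 0) /\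
    (forall n y, y \in U n <-> exists x, u n x = y).
Proof.
move=> stU pU.
have /fisoE[u [ui us]] := pure_classification (pure_subrep stU pU).
exists _, (hcomp u (fsubinc stU)); split=> n y.
  rewrite comp_lfunE => uy; apply: ui; apply: (@fsubinc_inj _ _ stU).
  by rewrite uy linear0.
split=> [/(fsubinc_lift stU)[z <-] | [x <-]]; last by rewrite comp_lfunE fsubinc_mem.
by have [x <-] := us n z; exists x; rewrite comp_lfunE.
Qed.

Lemma resolution_step k V : gen_lt k.+2 V ->
  exists (P M D : frep) (e : fhom P V) (u : fhom (fsum M D) P),
  [/\ schur_projective k.+1 P, gen_lt k.+1 M, inj0 M & sum_of_D k.+1 k.+2 D] /\
  [/\ fepi e, fexact u e & forall n x, u n x = 0 -> x = 0].
Proof.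
move=> gV; have [M [A [B [stM stA stB [[gM pA pB] [MA MAB kerE]]]]]] :=
  kernel_structure V k.+1.
have [a [ua [ua_inj uaP]]] := fsubrep_pure_sum stA pA.
have [b [ub [ub_inj ubP]]] := fsubrep_pure_sum stB pB.
pose P := fcover V k.+2.
exists P, (fsubrep stM),
  (fsum (fsums (nseq a (Drep k.+1))) (fsums (nseq b (Drep k.+2)))),
  (cover_map V k.+2), (hcopair (fsubinc stM) (hcopair ua ub)).
have uaA n x : ua n x \in A n by apply/uaP; exists x.
have ubB n x : ub n x \in B n by apply/ubP; exists x.
have incE n x v w : hcopair (fsubinc stM) (hcopair ua ub) n (x, (v, w)) =
    fsubinc stM n x + ua n v + ub n w by rewrite !hcopairE addrA.
split; split.
- exact: fcover_schur_projective.
- exact: gen_lt_subrep.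
- move=> n f x /(congr1 (fsubinc stM n)); rewrite fhom_nat linear0 => /fcover_inj0 x0.
  by apply: (@fsubinc_inj _ _ stM); rewrite x0 linear0.
- by exists a, b; apply: fiso_sums_cat.
- exact: fcover_epi.
- apply/fexactP => n y.
  have kerP z : cover_map V k.+2 n z = 0 <-> z \in (M n + A n + B n)%VS.
    by rewrite kerE memv_ker; split=> /eqP.
  split=> [/kerP | [[x [v w]] <-]].
    case/memv_addP=> _ /memv_addP[_ /(fsubinc_lift stM)[x <-] [_ /uaP[v <-] ->]].
    case=> _ /ubP[w <-] ->; exists (x, (v, w)).
    by rewrite incE.
  by apply/kerP; rewrite incE !memv_add ?fsubinc_mem ?uaA ?ubB.
move=> n [x [v w]]; rewrite incE => /eqP.
rewrite addr_eq0 => /eqP e.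
have MAx : fsubinc stM n x + ua n v \in (M n + A n)%VS.
  by rewrite memv_add ?fsubinc_mem ?uaA ?ubB.
have w0 : w = 0.
  apply: ub_inj; apply/eqP; rewrite -memv0 -(MAB n) memv_cap ubB andbT.
  by rewrite -rpredN -e.
move: e; rewrite w0 linear0 oppr0 => /eqP; rewrite addr_eq0 => /eqP e.
have v0 : v = 0.
  apply: ua_inj; apply/eqP; rewrite -memv0 -(MA n) memv_cap uaA andbT.
  by rewrite -rpredN -e fsubinc_mem.
suff -> : x = 0 by rewrite v0.
by apply: (@fsubinc_inj _ _ stM); rewrite e v0 linear0 oppr0 linear0.
Qed.

(** Every value of the cover is the image of its value at [0], where the kernel is
  zero; as V[0] maps injectively to V[n], the kernel is zero at [n] too. *)
Lemma fcover1_mono V : gen_lt 1 V -> inj0 V -> fmono (cover_map V 1).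
Proof.
move=> gV V0 n; apply: lker0I => x e.
have : x \in (\sum_(f : fmor 0 n) (rmap (fcover V 1) f @: fullv))%VS.
  have := subvP (gen_fcover V 1 n) x (memvf x).
  by rewrite /gsub big_ord1.
pose f0 : fmor 0 n := [ffun i : 'I_0 => False_rect _ (notF (ltn_ord i))].
rewrite (big_pred1 f0) => [/memv_imgP[y _ xE]|f]; last first.
  by apply/esym/eqP/ffunP=> -[].
rewrite xE; suff -> : y = 0 by rewrite linear0.
have ey : cover_map V 1 0 y = 0 by apply: (V0 n f0); rewrite -fhom_nat -xE.
have [M [A [B [_ _ _ [[gM pA pB] [_ _ kerE]]]]]] := kernel_structure V 0.
have /memv_addP[_ /memv_addP[m Mm [a Aa ->]] [b Bb ->]] :
    y \in (M 0%N + A 0%N + B 0%N)%VS.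
  by rewrite kerE memv_ker ey.
have : m \in gsub 0 M 0 by apply: subvP (gM _) _ Mm.
rewrite /gsub big_ord0 memv0 => /eqP->.
have [kA _] := pA; rewrite -(kA _ _ Aa) koszul_deg0.
by have [kB _] := pB; rewrite -(kB _ _ Bb) koszul_low // !addr0.
Qed.

(** For k = 0 this says that e is an isomorphism, which gives the induction on k
  its starting point. *)
Definition resolved (k : nat) (V : frep) : Prop :=
  exists (P D : nat -> frep)
         (d : forall i, fhom (res_term P D i.+1) (res_term P D i))
         (e : fhom (res_term P D 0) V),
    (forall i, (i <= k)%N -> schur_projective (k - i) (P i)) /\
    (forall i, (0 < i <= k)%N -> sum_of_D (k - i + 1) (k - i + 2) (D i)) /\
    fepi e /\
    ((0 < k)%N -> fexact (d 0%N) e) /\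
    (forall i, (i.+1 < k)%N -> fexact (d i.+1) (d i)) /\
    (if k is k'.+1 then fmono (d k') else fmono e).

(** A resolution of M is spliced onto 0 -> M + D1 -> P0 -> V -> 0, which shifts its
  terms by one; D1 joins the new term of index 1. *)
Section Splice.
Variables (P0 M D1 : frep) (u : fhom (fsum M D1) P0).
Variables (P' D' : nat -> frep).
Variable d' : forall i, fhom (res_term P' D' i.+1) (res_term P' D' i).
Variable e' : fhom (res_term P' D' 0) M.

Definition spliceP i := if i is i'.+1 then P' i' else P0.
Definition spliceD i :=
  match i with 0%N => fzero | 1%N => D1 | i'.+2 => D' i'.+1 end.

Definition splice0 : fhom (fsum (P' 0) D1) P0 :=
  hcomp (hpair (hcomp (hfst (P' 0) D1) e') (hsnd (P' 0) D1)) u.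
Definition splice1 : fhom (res_term P' D' 1) (fsum (P' 0) D1) :=
  hcomp (d' 0) (hinl (P' 0) D1).

Definition spliced i :
    fhom (res_term spliceP spliceD i.+1) (res_term spliceP spliceD i) :=
  match i with
  | 0%N => splice0
  | 1%N => splice1
  | i'.+2 => d' i'.+1
  end.

Lemma splice0E n x y : splice0 n (x, y) = u n (e' n x, y).
Proof. by rewrite comp_lfunE hpairE comp_lfunE hfstE hsndE. Qed.

Lemma splice1E n x : splice1 n x = (d' 0 n x, 0).
Proof. by rewrite comp_lfunE hinlE. Qed.

End Splice.

Lemma resolution k V : gen_lt k.+1 V -> (k = 0%N -> inj0 V) -> resolved k V.
Proof.
elim: k V => [|k IH] V gV V0.
  exists (fun => fcover V 1), (fun => fzero), (fun => hzero _ _), (cover_map V 1).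
  split=> [i | ]; first by rewrite leqn0 => /eqP->; apply: fcover_schur_projective.
  split=> [i|]; first by case: i.
  split; [exact: fcover_epi | split=> //; split=> //].
  exact: fcover1_mono gV (V0 erefl).
have [P0 [M [D1 [e [u [[sP0 gM M0 sD1] [e_epi ue u_inj]]]]]]] := resolution_step gV.
have [P' [D' [d' [e' [sP' [sD' [e'_epi [d'e' [d'd' mono']]]]]]]]] := IH M gM (fun => M0).
exists (spliceP P0 P'), (spliceD D1 D'), (spliced u d' e'), e.
split=> [[|i] ik|]; [by rewrite subn0 | by rewrite subSS; apply: sP' | ].
split=> [[|[|i]] //= ik|].
- by rewrite subSS subn0 addn1 addn2.
- by rewrite subSS; apply: sD'.
split=> //; split=> [_|].
  apply/fexactP => n y; split=> [/(proj1 (fexactP _ _) ue)[[m w] <-] | [[x w] <-]].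
    have [x <-] := proj2 (limg_fullP _) (e'_epi n) m.
    by exists (x, w); rewrite /= splice0E.
  by apply/(proj1 (fexactP _ _) ue); rewrite /= splice0E; exists (e' n x, w).
split=> [[|[|i]] ik|].
- apply/fexactP => n [x w]; rewrite /= splice0E; split.
    move/u_inj=> [ex ->].
    have [z <-] := proj1 (proj1 (fexactP _ _) (d'e' ik) n x) ex.
    by exists z; rewrite splice1E.
  case=> z; rewrite splice1E => -[<- <-].
  rewrite (proj2 (proj1 (fexactP _ _) (d'e' ik) n _)) ?linear0 //.
  by exists z.
- apply/fexactP => n x; rewrite /= splice1E.
  have ex := proj1 (fexactP _ _) (d'd' 0%N ik) n x.
  by split=> [[/ex]|/ex->].
- exact: d'd'.
case: k {IH gV V0 sP0 gM sD1 sP' sD' e_epi} M0 d'e' d'd' mono' =>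
  [|[|k]] M0 d'e' d'd' mono' //= n.
  apply: lker0I => -[x w]; rewrite splice0E => /u_inj[ex ->].
  by rewrite (lker0_eq0 (mono' n) ex).
apply: lker0I => x; rewrite splice1E => -[dx].
exact: lker0_eq0 (mono' n) dx.
Qed.

Lemma gen_schur k W : gen_lt k (fsums [seq schur_at W j | j <- iota 0 k]).
Proof.
have: all (fun j => (j < k)%N) (iota 0 k).
  by apply/allP => j; rewrite mem_iota.
elim: (iota 0 k) => [_|j s IH /= /andP[jk sk]]; first exact: gen_lt_fzero.
apply: gen_lt_sum (IH sk); apply: gen_lt_mono jk _.
by apply: gen_lt_epi (@gen_ftens (W j) j) => n y; apply: quotmap_sur.
Qed.

Lemma has_degree_gen k V : has_degree k V -> gen_lt k.+1 V.
Proof.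
case=> P [u [[W [_ /fiso_sym/fisoE[v [_ vs]]]] ue]].
apply: (gen_lt_epi (u := u)); first by move=> n; apply/limg_fullP.
by apply: (gen_lt_epi vs); apply: gen_schur.
Qed.
Local Close Scope ring_scope.
Unset Implicit Arguments.

Theorem theorem6p39 (k : nat) (k_gt0 : 0 < k) (V : frep)
    (V_fg : finitely_generated V) (V_deg : has_degree k V) :
  exists (P D : nat -> frep)
         (d : forall i, fhom (res_term P D i.+1) (res_term P D i))
         (e : fhom (res_term P D 0) V),
    (forall i, i <= k -> schur_projective (k - i) (P i)) /\
    (forall i, 0 < i <= k -> sum_of_D (k - i + 1) (k - i + 2) (D i)) /\
    fepi e /\
    fexact (d 0) e /\
    (forall i, i.+1 < k -> fexact (d i.+1) (d i)) /\
    fmono (d k.-1).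
Proof.
have k_neq0 : k = 0 -> inj0 V by move=> k0; rewrite k0 in k_gt0.
have [P [D [d [e [sP [sD [e_epi [de [dd mono]]]]]]]]] :=
  resolution (has_degree_gen V_deg) k_neq0.
exists P, D, d, e; split=> //; split=> //; split=> //; split; first exact: de.
split=> //; by case: (k) k_gt0 mono.
Qed.
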